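(* All of the following hold. (1) $\mathrm{obs}_{\mathrm{out}}(X_4) = 2$. (2) $\mathrm{obs}_{\mathrm{out}}(I) = \mathrm{obs}_{\mathrm{out}}(X_5) = 2$, where $I = X_5$ is the graph of the icosahedron. (3) $\mathrm{obs}_{\mathrm{out}}(X_6) = 2$.
   Context: All graphs are finite, simple, and undirected. A straight-line drawing of a graph $G$ in the plane places the vertices at distinct points of $\mathbb{R}^2$ and draws each edge as the closed line segment joining its endpoints; the drawing is regarded as the union of all vertex points and edge segments. A non-edge of $G$ is a pair of distinct vertices $a,b$ such that $ab$ is not an edge of $G$; in a drawing it is identified with the line segment joining $a$ and $b$. An obstacle representation of $G$ is a straight-line drawing of $G$ in the plane together with a collection of connected subsets of the plane, called obstacles, such that no obstacle meets the drawing of $G$, while every non-edge of $G$ intersects at least one obstacle. The obstacle number $\mathrm{obs}(G)$ is the least number of obstacles in an obstacle representation of $G$. An outside obstacle is an obstacle contained in the unbounded component of the complement of the drawing of $G$. The outside obstacle number $\mathrm{obs}_{\mathrm{out}}(G)$ is the least number of obstacles in an obstacle representation of $G$ in which one of the obstacles is an outside obstacle, or zero if $\mathrm{obs}(G)=0$. For $n \ge 3$, $X_n$ denotes the $1$-skeleton of the gyroelongated $n$-bipyramid (the convex polyhedron obtained from the $n$-antiprism by adding pyramids on the top and bottom bases). Explicitly, $X_n$ has $2n+2$ vertices $p, q, a_1,\dots,a_n, b_1,\dots,b_n$, and its edges are (indices modulo $n$): $a_i a_{i+1}$, $b_i b_{i+1}$, $p a_i$, $q b_i$, $a_i b_i$,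 and $b_i a_{i+1}$ for $1 \le i \le n$. The graph $X_5$ is the graph of the icosahedron, also denoted $I$. *)

(* Defs.v *)
From HB Require Import structures.
From mathcomp Require Import all_boot all_order all_algebra.
From mathcomp Require Import all_classical all_reals all_analysis.
Set Implicit Arguments.
Unset Strict Implicit.
Unset Printing Implicit Defensive.
Import Order.TTheory GRing.Theory Num.Theory.
Import numFieldNormedType.Exports.
Local Open Scope classical_set_scope.
Local Open Scope ring_scope.

Record sgraph := SGraph {
  vertex :> finType;
  adj : rel vertex;
  adj_sym : symmetric adj;
  adj_irr : irreflexive adj }.

Definition nonedge (G : sgraph) (u v : G) : bool := (u != v) && ~~ adj u v.

Definition segment (R : realType) (x y : R * R) : set (R * R) :=
  [set (1 - t) *: x + t *: y | t in `[0, 1]].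

(* A straight-line drawing is given by an injective placement of the vertices;
   injectivity is part of [obstacle_representation] below.  A vertex may lie in
   the interior of an edge, and edges may overlap. *)
Definition drawing (R : realType) (G : sgraph) (f : G -> R * R) :
    set (R * R) :=
  [set z | (exists v : G, z = f v) \/
           (exists u v : G, adj u v /\ segment (f u) (f v) z)].

(* [connected set0] holds in the library, so obstacles are explicitly required
   to be nonempty; otherwise [set0] would count as an outside obstacle. *)
Definition obstacle_representation (R : realType) (G : sgraph)
    (f : G -> R * R) (k : nat) (O : 'I_k -> set (R * R)) : Prop :=
  [/\ injective f,
      forall i, O i !=set0 /\ connected (O i),
      forall i, O i `&` drawing f = set0 &
      forall u v : G, nonedge u v ->
        exists i, (O i `&` segment (f u) (f v)) !=set0].

(* [connected_component A x] is empty when [x] is not in [A], and the empty set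
   is bounded, so the component below is a genuine component of the complement
   of the drawing. *)
Definition outside_obstacle (R : realType) (G : sgraph) (f : G -> R * R)
    (B : set (R * R)) : Prop :=
  exists x : R * R,
    let C := connected_component (~` drawing f) x in
    ~ bounded_set C /\ B `<=` C.

(* The default value 0 is returned when no natural number satisfies [P]. *)
Definition least (P : nat -> Prop) : nat :=
  xget 0%N [set k | P k /\ forall m : nat, P m -> (k <= m)%N].

Definition obs (R : realType) (G : sgraph) : nat :=
  least (fun k => exists (f : G -> R * R) (O : 'I_k -> set (R * R)),
    obstacle_representation f O).

Definition obs_out (R : realType) (G : sgraph) : nat :=
  if obs R G == 0%N then 0%N else
  least (fun k => exists (f : G -> R * R) (O : 'I_k -> set (R * R)),
    obstacle_representation f O /\ exists i, outside_obstacle f (O i)).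

Inductive gyro_vertex (n : nat) : Type :=
  | P_ | Q_ | A_ of 'I_n | B_ of 'I_n.
Arguments P_ {n}.
Arguments Q_ {n}.

Definition gyro_vertex_code n (v : gyro_vertex n) : bool + (bool * 'I_n) :=
  match v with
  | P_ => inl true | Q_ => inl false
  | A_ i => inr (true, i) | B_ i => inr (false, i)
  end.

Definition gyro_vertex_decode n (c : bool + (bool * 'I_n)) : gyro_vertex n :=
  match c with
  | inl b => if b then P_ else Q_
  | inr (b, i) => if b then A_ i else B_ i
  end.

Lemma gyro_vertex_codeK n :
  cancel (@gyro_vertex_code n) (@gyro_vertex_decode n).
Proof. by case. Qed.

HB.instance Definition _ n := Equality.copy (gyro_vertex n)
  (can_type (@gyro_vertex_codeK n)).
HB.instance Definition _ n := Choice.copy (gyro_vertex n)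
  (can_type (@gyro_vertex_codeK n)).
HB.instance Definition _ n := Countable.copy (gyro_vertex n)
  (can_type (@gyro_vertex_codeK n)).
HB.instance Definition _ n := Finite.copy (gyro_vertex n)
  (can_type (@gyro_vertex_codeK n)).

(* Each edge in one orientation; [ordS] is the successor modulo n. *)
Definition gyro_arc n (u v : gyro_vertex n) : bool :=
  match u, v with
  | P_, A_ _ => true
  | Q_, B_ _ => true
  | A_ i, A_ j => j == ordS i
  | B_ i, B_ j => j == ordS i
  | A_ i, B_ j => j == i
  | B_ i, A_ j => j == ordS i
  | _, _ => false
  end.

(* The conjunct [u != v] is redundant for n >= 2; it lets the graph be defined
   for every n. *)
Definition gyro_adj n (u v : gyro_vertex n) : bool :=
  (u != v) && (gyro_arc u v || gyro_arc v u).

Lemma gyro_adj_sym n : symmetric (@gyro_adj n).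
Proof. by move=> u v; rewrite /gyro_adj eq_sym orbC. Qed.

Lemma gyro_adj_irr n : irreflexive (@gyro_adj n).
Proof. by move=> u; rewrite /gyro_adj eqxx. Qed.

Definition gyro_bipyramid (n : nat) : sgraph :=
  SGraph (@gyro_adj_sym n) (@gyro_adj_irr n).

Definition icosahedron : sgraph := gyro_bipyramid 5.

(* Main.v *)
Require Import Defs.
From Stdlib Require Import ZArith Ascii String.
From mathcomp Require Import all_boot all_order all_algebra.
From mathcomp Require Import all_classical all_reals all_analysis.
From mathcomp Require Import ring lra zify ssrZ.
Set Implicit Arguments.
Unset Strict Implicit.
Unset Printing Implicit Defensive.

(** Lower bound. Suppose that one obstacle, inside the unbounded component [C] of the
    complement of the drawing, meets every non-edge. The parity of the number of edges of
    a closed walk that are hit by a ray from [z] is locally constant in [z] off the walk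
    and vanishes far away, so it vanishes on [C]. If a non-edge [ab] had a path from [a]
    to [b] strictly on the left of the line [ab] and another one strictly on the right,
    the parity would be odd along [ab] for rays in direction [ab]. The parity is also
    stable when the drawing moves together with the point of [ab], so these conditions
    persist after a small perturbation into general position. The orientations of the
    triples of vertices then satisfy the four-point and the Pluecker sign conditions, and
    each non-edge has a side without path between its ends. For [X_4], [X_5] and [X_6]
    these Boolean conditions are contradictory; the contradiction is a list of clauses,
    each following from the conditions and from images of earlier clauses under graph
    automorphisms and mirror reflection by unit propagation.

    Upper bound. In explicit integer drawings one obstacle is a polygonal line together
    with a ray to infinity, and the other one a polygonal line; everything reduces to
    signs of integer determinants. *)

(** * Refuting orientations by unit propagation *)

(** The given drawing may be degenerate: vertices may be collinear or lie inside edges, and edges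
    may overlap. So no planar topology is used, only parities of ray hits, which depend on finitely
    many signs. The component [C] lives in the original drawing, where the parity is even; the
    enclosing paths are considered in the perturbed drawing, where it would be odd; the stability of
    parities links the two. The whole component replaces the obstacle, since the obstacle itself may
    be bounded.

    The side from which a non-edge [ab] can be reached is one unknown bit. Writing it as the
    orientation of [a], [b] and a fictitious point [n] lets automorphisms and reflection act on it
    as on all other orientations. No four-point or Pluecker condition mentions [n], because no
    actual point need realise all these bits. Every condition of a model says that certain bits are
    not all equal, so the negation of a model is a model. A derived clause lacks this invariance, so
    its mirrored form is extra information. *)

Definition lit : Type := nat * nat * nat.

(* Read as: the exclusive disjunctions of the inner lists are not all equal. An empty
   inner list counts as [false], so a clause is a list of singletons and one empty list. *)
Definition constraint : Type := seq (seq lit).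

Definition clause (ls : seq lit) : constraint := rcons [seq [:: l] | l <- ls] [::].

Definition value (chi : nat -> nat -> nat -> bool) (l : lit) : bool :=
  let: (a, b, c) := l in chi a b c.

Definition xor_all : seq bool -> bool := foldr addb false.

Definition holds chi (C : constraint) : bool :=
  ~~ constant [seq xor_all [seq value chi l | l <- t] | t <- C].

(* Signed areas satisfy [pqr = tqr + ptr + pqt]. *)
Definition four_points (p q r t : nat) : constraint :=
  [:: [:: (t, q, r)]; [:: (p, t, r)]; [:: (p, q, t)]; [:: (q, p, r)]].

(* Signed areas satisfy [tsp * tqr + tqs * tpr + tsr * tpq = 0]. *)
Definition plucker (t s p q r : nat) : constraint :=
  [:: [:: (t, s, p); (t, q, r)]; [:: (t, q, s); (t, p, r)]; [:: (t, s, r); (t, p, q)]].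

(* [a, s, b] is a path and the obstacle reaches the non-edge [ab] from the side where [n]
   lies, so the path cannot stay on that side. *)
Definition blocked (n a b : nat) (s : seq nat) : constraint :=
  rcons [seq [:: (a, b, x)] | x <- s] [:: (a, b, n)].

Definition valid_lit (n : nat) (l : lit) : bool :=
  let: (a, b, c) := l in
  [&& ~~ eqn a b, ~~ eqn a c, ~~ eqn b c, Nat.leb a n, Nat.leb b n & Nat.leb c n].

(* Abstract orientations of the points [0, ..., n - 1]; the extra symbol [n] occurs as a
   point at which the obstacle is based, see [blocked]. *)
Record model (n : nat) (e : rel nat) (chi : nat -> nat -> nat -> bool) : Prop := {
  model_swap : forall a b c, valid_lit n (a, b, c) -> chi b a c = ~~ chi a b c;
  model_rot : forall a b c, valid_lit n (a, b, c) -> chi b c a = chi a b c;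
  model_four_points : forall p q r t, all (ltn^~ n) [:: p; q; r; t] ->
    uniq [:: p; q; r; t] -> holds chi (four_points p q r t);
  model_plucker : forall t s p q r, all (ltn^~ n) [:: t; s; p; q; r] ->
    uniq [:: t; s; p; q; r] -> holds chi (plucker t s p q r);
  model_blocked : forall a b s, all (ltn^~ n) [:: a, b & s] -> uniq [:: a, b & s] ->
    ~~ e a b -> path e a (rcons s b) -> holds chi (blocked n a b s) }.

(** Sorts the triple by three compare-exchanges and records whether the permutation is odd, so that
    an assignment needs only one entry per set of three points. *)
Definition canon (l : lit) : lit * bool :=
  let: (a, b, c) := l in
  let: (a, b, s) := if Nat.ltb b a then (b, a, true) else (a, b, false) in
  let: (b, c, s) := if Nat.ltb c b then (c, b, negb s) else (b, c, s) in
  if Nat.ltb b a then (b, a, c, negb s) else (a, b, c, s).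

(** Nested conditionals stop early, whereas [vm_compute] would evaluate both arguments of [&&]. *)
Definition eq_lit (k l : lit) : bool :=
  let: (a, b, c) := k in let: (a', b', c') := l in
  if eqn a a' then if eqn b b' then eqn c c' else false else false.

Fixpoint lookup (k : lit) (asg : seq (lit * bool)) : option bool :=
  if asg is (k', v) :: asg' then if eq_lit k k' then Some v else lookup k asg' else None.

Definition eval_lit asg (l : lit) : option bool :=
  let: (k, s) := canon l in omap (addb s) (lookup k asg).

Fixpoint eval_term asg (t : seq lit) : option bool :=
  if t is l :: t' then
    match eval_lit asg l, eval_term asg t' with
    | Some x, Some y => Some (addb x y)
    | _, _ => None
    end
  else Some false.

Fixpoint all_eval asg (v : bool) (C : constraint) : bool :=
  if C is t :: C' then
    if eval_term asg t is Some x then if x (+) v then false else all_eval asg v C' else false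
  else true.

Definition violated asg (C : constraint) : bool :=
  if C is t :: C' then if eval_term asg t is Some v then all_eval asg v C' else false
  else true.

(** The first open literal suffices: if a second one is open, neither value of the first violates
    the constraint, and [refute] fails. So the hints must come in an order in which each one
    propagates or gives the conflict. *)
Fixpoint unassigned asg (ls : seq lit) : option lit :=
  if ls is l :: ls' then if eval_lit asg l is None then Some l else unassigned asg ls'
  else None.

Definition assign asg (l : lit) (v : bool) : seq (lit * bool) :=
  let: (k, s) := canon l in (k, addb s v) :: asg.

(* [refute n Cs asg]: unit propagation through the constraints [Cs], in this order and
   starting from [asg], ends in a conflict. *)
Fixpoint refute (n : nat) (Cs : seq constraint) (asg : seq (lit * bool)) : bool :=
  if Cs is C :: Cs' then
    if all (valid_lit n) (flatten C) then
      if unassigned asg (flatten C) is Some l then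
        if violated (assign asg l true) C then refute n Cs' (assign asg l false)
        else if violated (assign asg l false) C then refute n Cs' (assign asg l true)
        else false
      else violated asg C
    else false
  else false.

Definition agrees chi (asg : seq (lit * bool)) : Prop :=
  forall k v, (k, v) \in asg -> value chi k = v.

Section Refutation.
Variables (n : nat) (e : rel nat) (chi : nat -> nat -> nat -> bool).
Hypothesis chiP : model n e chi.

Lemma valid_litP a b c :
  reflect [/\ a != b, a != c, b != c & [/\ a <= n, b <= n & c <= n]] (valid_lit n (a, b, c)).
Proof.
have lebE x y : Nat.leb x y = (x <= y) by apply/idP/leP => /PeanoNat.Nat.leb_le.
rewrite /valid_lit !lebE; apply: (iffP and4P) => [[? ? ? /and3P[]]|[? ? ? [? ? ?]]].
  by split.
by split=> //; apply/and3P.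
Qed.

Lemma valid_lit_swap a b c : valid_lit n (a, b, c) -> valid_lit n (b, a, c).
Proof.
by move/valid_litP => [ab ac bc [? ? ?]]; apply/valid_litP; split=> //; rewrite eq_sym.
Qed.

Lemma valid_lit_rot a b c : valid_lit n (a, b, c) -> valid_lit n (b, c, a).
Proof.
by move/valid_litP => [ab ac bc [? ? ?]]; apply/valid_litP; split; rewrite // eq_sym.
Qed.

Lemma model_swapr a b c : valid_lit n (a, b, c) -> chi a c b = ~~ chi a b c.
Proof.
move=> abc; have cab := valid_lit_rot (valid_lit_rot abc).
by rewrite (model_swap chiP cab) -(model_rot chiP cab).
Qed.

Lemma value_canon l : valid_lit n l -> value chi l = (canon l).2 (+) value chi (canon l).1.
Proof.
case: l => [[a b] c] abc; rewrite /canon.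
have swap a' b' c' := @valid_lit_swap a' b' c'.
have swapr a' b' c' (h : valid_lit n (a', b', c')) :=
  swap _ _ _ (valid_lit_rot (valid_lit_rot h)).
have rot a' b' c' := @valid_lit_rot a' b' c'.
(* The last compare-exchange, treated once for all outcomes of the first two. *)
have key a' b' c' s : valid_lit n (a', b', c') -> value chi (a, b, c) = s (+) chi a' b' c' ->
  value chi (a, b, c) = (if Nat.ltb b' a' then (b', a', c', negb s) else (a', b', c', s)).2 (+)
    value chi (if Nat.ltb b' a' then (b', a', c', negb s) else (a', b', c', s)).1.
  move=> h ->; case: ifP => _ //=; rewrite (model_swap chiP h).
  by rewrite addNb addbN negbK.
case: ifP => _; case: ifP => _; apply: key => //=.
- exact: rot.
- by rewrite (model_rot chiP abc).
- exact: swap.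
- by rewrite (model_swap chiP abc) negbK.
- exact: swapr.
- by rewrite (model_swapr abc) negbK.
Qed.

Lemma eq_litP k l : reflect (k = l) (eq_lit k l).
Proof.
case: k l => [[a b] c] [[a' b'] c'] /=; apply: (iffP idP).
  by case: eqnP => // ->; case: eqnP => // -> /eqnP ->.
by case=> -> -> ->; rewrite !(introT eqnP erefl).
Qed.

Lemma lookup_agrees asg k v : agrees chi asg -> lookup k asg = Some v -> value chi k = v.
Proof.
move=> ag; elim: asg ag => //= -[k' v'] asg IH ag.
case: eq_litP => [-> [<-]|_]; first by apply: ag; rewrite mem_head.
by apply: IH => k0 v0 h; apply: ag; rewrite inE h orbT.
Qed.

Lemma eval_lit_agrees asg l v : agrees chi asg -> valid_lit n l ->
  eval_lit asg l = Some v -> value chi l = v.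
Proof.
move=> ag ok; rewrite (value_canon ok) /eval_lit; case: (canon l) => k s /=.
by case E: lookup => [w|] //= [<-]; rewrite (lookup_agrees ag E).
Qed.

Lemma eval_term_agrees asg t v : agrees chi asg -> all (valid_lit n) t ->
  eval_term asg t = Some v -> xor_all [seq value chi l | l <- t] = v.
Proof.
move=> ag; elim: t v => [v _ [] //|l t IH v /= /andP[ok okt]].
case E: eval_lit => [x|] //; case F: eval_term => [y|] // [<-].
by rewrite (eval_lit_agrees ag ok E) (IH _ okt F).
Qed.

Lemma violated_agrees asg C : agrees chi asg -> all (valid_lit n) (flatten C) ->
  violated asg C -> ~~ holds chi C.
Proof.
move=> ag; case: C => [//|t C] /=; rewrite all_cat => /andP[okt okC].
case E: eval_term => [v|] // hC; rewrite negbK /=; rewrite (eval_term_agrees ag okt E).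
elim: C okC hC => //= u C IH; rewrite all_cat => /andP[oku okC].
case F: eval_term => [x|] //; case: ifP => // xv hC.
by rewrite (eval_term_agrees ag oku F) IH // andbT; move: xv; rewrite -negb_eqb => /negbFE.
Qed.

Lemma assign_agrees asg l v : agrees chi asg -> valid_lit n l -> value chi l = v ->
  agrees chi (assign asg l v).
Proof.
move=> ag ok <- k w; rewrite /assign; have := value_canon ok.
case: (canon l) => k' s /= ->; rewrite inE => /predU1P[[-> ->]|]; last exact: ag.
by rewrite addbA addbb.
Qed.

Lemma unassigned_mem asg ls l : unassigned asg ls = Some l -> l \in ls.
Proof.
elim: ls => //= k ls IH; case: eval_lit => [_ /IH h|[<-]]; first by rewrite inE h orbT.
exact: mem_head.
Qed.

(** The value that [chi] gives to the open literal cannot violate a constraint that holds, so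
    propagation never discards it and the assignment keeps agreeing with [chi]. *)
Lemma refute_sound Cs asg : agrees chi asg -> all (holds chi) Cs -> ~~ refute n Cs asg.
Proof.
move=> ag hCs; elim: Cs asg ag hCs => //= C Cs IH asg ag /andP[hC hCs].
case: ifP => // ok; case E: unassigned => [l|]; last first.
  by apply: contraL hC => /(violated_agrees ag ok).
have okl : valid_lit n l by move/allP: ok; apply; exact: unassigned_mem E.
have bad v : value chi l = v -> ~~ violated (assign asg l v) C.
  move=> lv; apply: contraL hC; exact: violated_agrees (assign_agrees ag okl lv) ok.
have next v : value chi l = v -> ~~ refute n Cs (assign asg l v).
  by move=> lv; apply: IH => //; exact: assign_agrees.
case V: (value chi l).
  by rewrite (negbTE (bad _ V)); case: ifP => // _; exact: next.
by case: ifP => _; [exact: next|rewrite (negbTE (bad _ V))].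
Qed.

End Refutation.

(** * Symmetries of models: graph automorphisms and mirror reflection *)

Section Symmetry.
Variables (n : nat) (e : rel nat).
Implicit Types (chi : nat -> nat -> nat -> bool) (m : seq nat).

Definition permute m (l : lit) : lit :=
  let: (a, b, c) := l in (nth 0 m a, nth 0 m b, nth 0 m c).

(** Exchanging two points negates a literal, so mirrored clauses need no syntax for negation. *)
Definition flip (l : lit) : lit := let: (a, b, c) := l in (b, a, c).

(** The extra entry fixes the fictitious point [n], so that [blocked] constraints go to [blocked]
    constraints. *)
Definition automorphism m : bool :=
  [&& size m == n.+1, all (fun i => i <= n) m, uniq m, nth 0 m n == n &
      all (fun i => all (fun j => e (nth 0 m i) (nth 0 m j) == e i j) (iota 0 n)) (iota 0 n)].

Lemma holds_map chi chi' (C : constraint) (f : lit -> lit) :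
  (forall l, l \in flatten C -> value chi (f l) = value chi' l) ->
  holds chi [seq [seq f l | l <- t] | t <- C] = holds chi' C.
Proof.
move=> ff; congr (~~ constant _); rewrite -map_comp; apply/eq_in_map => t tC /=.
rewrite -map_comp; congr xor_all; apply/eq_in_map => l lt; apply: ff.
by apply/flattenP; exists t.
Qed.

Lemma model_permute chi m : automorphism m -> model n e chi ->
  model n e (fun a b c => chi (nth 0 m a) (nth 0 m b) (nth 0 m c)).
Proof.
case/and5P=> /eqP sm mle um /eqP mn me chiP.
have m_le i : i <= n -> nth 0 m i <= n by move=> ?; move/all_nthP: mle; apply; rewrite sm.
have m_eq i j : i <= n -> j <= n -> (nth 0 m i == nth 0 m j) = (i == j).
  by move=> ? ?; rewrite nth_uniq // sm.
have m_lt i : i < n -> nth 0 m i < n.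
  move=> lt_in; rewrite ltn_neqAle m_le ?(ltnW lt_in) // andbT -[X in _ != X]mn.
  by rewrite m_eq ?(ltnW lt_in) // ltn_eqF.
have m_e i j : i < n -> j < n -> e (nth 0 m i) (nth 0 m j) = e i j.
  move=> lt_i lt_j; have /allP/(_ i) := me; rewrite mem_iota => /(_ lt_i) /allP/(_ j).
  by rewrite mem_iota => /(_ lt_j)/eqP.
have m_valid a b c : valid_lit n (a, b, c) ->
    valid_lit n (nth 0 m a, nth 0 m b, nth 0 m c).
  move/valid_litP => [ab ac bc [? ? ?]]; apply/valid_litP.
  by split; rewrite ?m_eq //; split; exact: m_le.
have m_all s : all (ltn^~ n) s -> all (ltn^~ n) [seq nth 0 m i | i <- s].
  by move=> /allP h; apply/allP => _ /mapP[i /h lt_i ->]; exact: m_lt.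
have m_uniq s : all (ltn^~ n) s -> uniq s -> uniq [seq nth 0 m i | i <- s].
  move=> /allP h us; rewrite map_inj_in_uniq // => i j /h li /h lj /eqP.
  by rewrite m_eq ?(ltnW li) ?(ltnW lj) // => /eqP.
split.
- by move=> a b c abc; rewrite (model_swap chiP) // m_valid.
- by move=> a b c abc; rewrite (model_rot chiP) // m_valid.
- move=> p q r t hlt hu.
  exact: (model_four_points chiP (m_all [:: p; q; r; t] hlt) (m_uniq [:: p; q; r; t] hlt hu)).
- move=> t s p q r hlt hu.
  exact: (model_plucker chiP (m_all [:: t; s; p; q; r] hlt) (m_uniq [:: t; s; p; q; r] hlt hu)).
- move=> a b s hlt hu nab ps; have /and3P[la lb ls] := hlt.
  have pm : path e (nth 0 m a) (rcons [seq nth 0 m i | i <- s] (nth 0 m b)).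
    have hm : all (ltn^~ n) (rcons s b) by rewrite all_rcons; apply/andP.
    rewrite -map_rcons; elim: (rcons s b) (a) la ps hm => //= i s' IH j lj.
    by case/andP=> eji ps' /andP[li ls']; rewrite m_e // eji IH.
  have nabm : ~~ e (nth 0 m a) (nth 0 m b) by rewrite m_e.
  have := model_blocked chiP (m_all [:: a, b & s] hlt) (m_uniq [:: a, b & s] hlt hu) nabm pm.
  rewrite -(@holds_map chi _ (blocked n a b s) (permute m)); last by case=> [[]].
  by rewrite /blocked map_rcons -!map_comp /= mn.
Qed.

(** When all lengths have the same parity, negating the literals negates either all or none of the
    exclusive disjunctions, and being all equal is unaffected. *)
Lemma holds_neg chi (C : constraint) (b : bool) : all (fun t => odd (size t) == b) C ->
  holds (fun x y z => ~~ chi x y z) C = holds chi C.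
Proof.
have xorE t : xor_all [seq value (fun x y z => ~~ chi x y z) l | l <- t] =
    odd (size t) (+) xor_all [seq value chi l | l <- t].
  elim: t => //= -[[x y] z] t -> /=.
  by case: (odd (size t)); case: (chi x y z); case: (xor_all _).
move=> odds; rewrite /holds; congr (~~ _).
have -> : [seq xor_all [seq value (fun x y z => ~~ chi x y z) l | l <- t] | t <- C] =
    [seq b (+) x | x <- [seq xor_all [seq value chi l | l <- t] | t <- C]].
  by rewrite -map_comp; apply/eq_in_map => t /(allP odds) /eqP tb; rewrite xorE tb.
case: [seq _ | t <- C] => //= x s; rewrite all_map; apply: eq_all => y /=.
by case: b {odds}; case: x; case: y.
Qed.

(** Mirror reflection. It exchanges the two sides of a line, so the literals at the fictitious point
    are negated as well. *)
Lemma model_neg chi : model n e chi -> model n e (fun a b c => ~~ chi a b c).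
Proof.
move=> chiP; split.
- by move=> a b c abc; rewrite (model_swap chiP).
- by move=> a b c abc; rewrite (model_rot chiP).
- by move=> p q r t hlt hu; rewrite (@holds_neg _ _ true) // (model_four_points chiP).
- by move=> t s p q r hlt hu; rewrite (@holds_neg _ _ false) // (model_plucker chiP).
- move=> a b s hlt hu nab ps; rewrite (@holds_neg _ _ true) ?(model_blocked chiP) //.
  by rewrite /blocked all_rcons /= all_map; apply/allP.
Qed.

End Symmetry.

(** * Certificates: derivations of clauses up to symmetry *)

Inductive hint :=
| Four of nat & nat & nat & nat
| Plucker of nat & nat & nat & nat & nat
| Blocked of nat & nat & seq nat
| Image of nat & nat & bool.

Section Certificate.
Variables (n : nat) (e : rel nat) (auts : seq (seq nat)).

(** Every hint is checked here. An improper one gives [None], is dropped by [pmap], and can at worst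
    make the refutation fail. *)
Definition justify (lemmas : seq constraint) (h : hint) : option constraint :=
  match h with
  | Four p q r t =>
    if all (ltn^~ n) [:: p; q; r; t] && uniq [:: p; q; r; t]
    then Some (four_points p q r t) else None
  | Plucker t s p q r =>
    if all (ltn^~ n) [:: t; s; p; q; r] && uniq [:: t; s; p; q; r]
    then Some (plucker t s p q r) else None
  | Blocked a b s =>
    if [&& all (ltn^~ n) [:: a, b & s], uniq [:: a, b & s], ~~ e a b & path e a (rcons s b)]
    then Some (blocked n a b s) else None
  | Image i j neg =>
    if (i < size lemmas) && (j < size auts)
    then Some [seq [seq permute (nth [::] auts j) (if neg then flip l else l) | l <- t]
              | t <- nth [::] lemmas i]
    else None
  end.

(* Each step is a clause with the constraints from which unit propagation derives it; the
   last clause is empty. *)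
Fixpoint certified (lemmas : seq constraint) (steps : seq (seq lit * seq hint)) : bool :=
  if steps is (ls, hs) :: steps' then
    if all (valid_lit n) ls then
      if refute n (pmap (justify lemmas) hs) (foldr (fun l asg => assign asg l false) [::] ls)
      then if ls is [::] then true else certified (rcons lemmas (clause ls)) steps'
      else false
    else false
  else false.

(** All models are quantified over, because the image of a clause is justified by the permuted or
    mirrored model. Validity of the literals is what makes [flip] a negation. *)
Definition lemma_of (C : constraint) : Prop :=
  all (valid_lit n) (flatten C) /\ forall chi, model n e chi -> holds chi C.

Hypothesis autsP : all (automorphism n e) auts.

Lemma justify_sound lemmas h C chi : (forall D, D \in lemmas -> lemma_of D) ->
  model n e chi -> justify lemmas h = Some C -> holds chi C.
Proof.
move=> lemP chiP; case: h => [p q r t|t s p q r|a b s|i j neg]; rewrite /justify.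
- by case: ifP => // /andP[hlt hu] [<-]; exact: (model_four_points chiP hlt hu).
- by case: ifP => // /andP[hlt hu] [<-]; exact: (model_plucker chiP hlt hu).
- by case: ifP => // /and4P[hlt hu nab ps] [<-]; exact: (model_blocked chiP hlt hu nab ps).
case: ifP => // /andP[lt_i lt_j] [<-].
have [ok lemH] := lemP _ (mem_nth [::] lt_i).
have mP := model_permute (allP autsP _ (mem_nth [::] lt_j)) chiP.
(* The image holds for [chi] because the lemma holds for [chi] composed with the automorphism,
   negated in the mirrored case. *)
rewrite (@holds_map chi (if neg then fun a b c => ~~ chi (nth 0 (nth [::] auts j) a)
  (nth 0 (nth [::] auts j) b) (nth 0 (nth [::] auts j) c) else fun a b c =>
  chi (nth 0 (nth [::] auts j) a) (nth 0 (nth [::] auts j) b) (nth 0 (nth [::] auts j) c))).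
  by case: neg; apply: lemH; [exact: model_neg|].
case=> [[a b] c] abc; case: neg => //=.
by rewrite (model_swap mP) //; exact: (allP ok).
Qed.

Lemma clause_lits ls : flatten (clause ls) = ls.
Proof. by rewrite /clause flatten_rcons cats0; elim: ls => //= l ls ->. Qed.

(** The empty list in [clause] has the value false, so if all entries are equal, every literal is
    false. *)
Lemma clause_false chi ls : ~~ holds chi (clause ls) -> all (fun l => ~~ value chi l) ls.
Proof.
rewrite negbK /clause map_rcons /= -map_comp /=.
have -> : [seq xor_all [seq value chi l | l <- [:: l0]] | l0 <- ls] =
    [seq value chi l | l <- ls].
  by apply: eq_map => l /=; rewrite addbF.
case: ls => //= l ls; rewrite all_rcons /= => /andP[/eqP <- h] /=.
by elim: ls h => //= k ls IH /andP[/eqP -> /IH].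
Qed.

Lemma certified_sound lemmas steps chi : (forall D, D \in lemmas -> lemma_of D) ->
  certified lemmas steps -> ~ model n e chi.
Proof.
move=> + + chiP; elim: steps lemmas => //= -[ls hs] steps IH lemmas lemP.
case: ifP => // ok; case: ifP => // ref.
have ls_lemma : lemma_of (clause ls).
  split; first by rewrite clause_lits.
  move=> chi' chiP'; apply: contraLR ref => /clause_false/allP fls.
  apply: (refute_sound chiP').
    elim: ls ok fls => [|l ls IHl] //= /andP[okl okls] fls.
    apply: (assign_agrees chiP' _ okl).
      by apply: IHl => // k kls; apply: fls; rewrite inE kls orbT.
    by apply/negbTE/fls; rewrite mem_head.
  elim: hs => //= h hs IHh; case E: (justify lemmas h) => [C|] //=.
  by rewrite (justify_sound lemP chiP' E).
(* The empty clause has a single entry, hence holds for no [chi]. *)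
case: ls ok ref ls_lemma => [_ _ [_ /(_ _ chiP)] //|l ls _ _ ls_lemma].
by apply: IH => D; rewrite mem_rcons inE => /predU1P[->|/lemP].
Qed.

End Certificate.

(** The low five bits of the code of a lower-case letter are its place in the alphabet, counted from
    one; hence the predecessor. *)
Definition letter (c : ascii) : nat :=
  let: Ascii b0 b1 b2 b3 b4 _ _ _ := c in
  (nat_of_bool b0 + (if b1 then 2 else 0) + (if b2 then 4 else 0) + (if b3 then 8 else 0) +
   (if b4 then 16 else 0)).-1.

(** [010] is the line feed, as the strings run over several lines. *)
Fixpoint words (s : string) (w : seq ascii) : seq (seq ascii) :=
  match s with
  | EmptyString => [:: rev w]
  | String " " s' | String "010" s' => rev w :: words s' [::]
  | String c s' => words s' (c :: w)
  end.

(* Letters stand for 0, 1, and so on. Words of three letters are the literals of the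
   clause, the other words are the hints in the order of propagation. *)
Fixpoint parse (ws : seq (seq ascii)) : seq lit * seq hint :=
  if ws is w :: ws' then
    let: (ls, hs) := parse ws' in
    match w with
    | [:: a; b; c] => ((letter a, letter b, letter c) :: ls, hs)
    | "@" :: [:: i; j; k] => (ls, Image (letter i * 26 + letter j) (letter k) false :: hs)
    | "!" :: [:: i; j; k] => (ls, Image (letter i * 26 + letter j) (letter k) true :: hs)
    | "-" :: a :: b :: s => (ls, Blocked (letter a) (letter b) [seq letter x | x <- s] :: hs)
    | [:: p; q; r; t] => (ls, Four (letter p) (letter q) (letter r) (letter t) :: hs)
    | [:: t; s; p; q; r] =>
      (ls, Plucker (letter t) (letter s) (letter p) (letter q) (letter r) :: hs)
    | _ => (ls, hs)
    end%char
  else ([::], [::]).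

Definition certificate (lines : seq string) : seq (seq lit * seq hint) :=
  [seq parse (words s [::]) | s <- lines].

(* The vertices of [X_n] are numbered [p, q, a_1, ..., a_n, b_1, ..., b_n]. *)
Definition gyro_arc_index (n i j : nat) : bool :=
  let succ k := k.+1 %% n in
  if i == 0 then 2 <= j < n + 2
  else if i == 1 then n + 2 <= j
  else if i < n + 2 then (j == 2 + succ (i - 2)) || (j == i + n)
  else (j == n + 2 + succ (i - (n + 2))) || (j == 2 + succ (i - (n + 2))).

Definition gyro_edge (n : nat) : rel nat :=
  [rel i j | gyro_arc_index n i j || gyro_arc_index n j i].

(** * Automorphisms of the antiprism with two apices *)

Definition rotate_index (n k i : nat) : nat :=
  if i < 2 then i else if i < n + 2 then 2 + (i - 2 + k) %% n
  else n + 2 + (i - (n + 2) + k) %% n.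

(** [a_i] goes to [a_{-i}] and [b_i] to [b_{-i-1}]; the shift by one exchanges the edges [a_i b_i]
    with the edges [b_i a_{i+1}]. *)
Definition reflect_index (n i : nat) : nat :=
  if i < 2 then i else if i < n + 2 then 2 + (n - (i - 2)) %% n
  else n + 2 + (n - (i - (n + 2)).+1) %% n.

(** Exchanges the two pyramids. Without the negation of indices, [b_i a_{i+1}] would become
    [a_i b_{i+1}], which is not an edge. *)
Definition swap_index (n i : nat) : nat :=
  if i < 2 then 1 - i else if i < n + 2 then n + 2 + (n - (i - 2)) %% n
  else 2 + (n - (i - (n + 2))) %% n.

(** The remainder of [k] modulo 4 selects swap and reflection, the quotient selects the rotation.
    For [n = 5] this is a proper subgroup of the automorphisms of the icosahedron. There are at most
    24 entries for the three graphs, so one letter names an entry in a hint. *)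
Definition gyro_automorphisms (n : nat) : seq (seq nat) :=
  [seq rcons [seq iter (k %% 2) (swap_index n)
                    (iter (k./2 %% 2) (reflect_index n) (rotate_index n (k %/ 4) i))
             | i <- iota 0 (2 * n + 2)] (2 * n + 2) | k <- iota 0 (4 * n)].

(* The certificates were found by a clause-learning SAT solver that closes what it learns
   under the symmetries. *)
Definition certificate4 : seq (seq lit * seq hint) := certificate [::
"dij dik eij icj -cij -die -dicj icdej -cide";
"bci cik bcj igj gcj -cif -gij -gib -bcj -bcg -cigb -gicf gbcij ibcfg -bfi cfib -bfj bcfgj
-fgib -fgc -fgj gcfij";
"fcg igj gcj cgi -gij -gicf -fgc gcfij -fgj";
"bcj icj gcj igj -cij -gij -gib -bcj -bcg @aba cbgij -gicf @aca -fgc gbcfi -fgib";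
"fcj cbi cbj bfg chi cfi icj ihj cbfij -bfgc -bfi -bfj fbcij icfhj @adm";
"cgi cfg gcj igj -fgc -fgj -gij -gib -gih gjic -gicf figc @ada -fgib -fgih gbcfi gcfhi !adc
cgib ghic -hjg -hji @aea jcfgi icfhj !adg @adm -bfj -bfi";
"ihj bfi fij chi icj -cij -cif @adm icfhj";
"ihj bfg cbi cbj gcj fgj igj icj chi -cij -cif @aea jcfgi !adg @aga -bfj -bfi";
"hgj cbg igj gci gcj -gij -gih !adc gchij";
"fgj cbj gcj icj igj gci -bcj -bcg -cij -gij -gib cbgij -cigh @aia -hjg -hji -fgj @aha -fgc
gbcfi -fgib";
"fij igj ghj gfj -hjg -hji jfghi @acm @afm";
"cgh icj gcj cbi gci cbg -cij -cigh cghij -chg cbghi -chjb";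
"cei chi cfi ech cfh cej cefhi -ceji -cef";
"cej cfh cfj icj gcj gci ech -cij -cif -cigh @ama cefij cegij -cef -cegh";
"dgj igj cdg gcj deg ceg idj icj ghj dgh deh egh -hjg -hji -djg jdghi gcdej @aak hdegj -eji
-ejhg";
"iej ifj ecj cfj icj -eji jcefi -ejf";
"dik egi ghi cdi eci chi -die -dih !afi icdeh";
"eci igj eij gci icj cdi feg deg gdi bei def bef ihj idj ibj cbi bhj cbj dgh dch cdg -gij
-gib -gih -cij -bcj -cigh icegj @aqa -die -dih edfgi ibdeg ebdfi ibdhj -bdie bchij -bdg -bdh
-bchd dbcgh";
"idj gcj gfj igj icj -gij -gib -gih -cij @ada -cif -bcj -bcg -fgj -fgc @aca fgic cfgij cbgij
-cigh @aia gbcfi cbfgj -hjg @aka -bfgc -hjb -hji -bfj @ala -chg gcfhi cfghi -chd -chfe -fhcg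
-fhe @ana !acp -cef cbefj fcegh cefgh -ced -egfc cdegh cdefh -egd -egh -dfc @akb -dfe dcegh
@apa -eji jcegi -ejf fbcej @aoa @aak gdhij -djc cdgij cdfhj jbchi jbcgh gbefj -begcf -bei
@ara icdej -die deghi -dih";
"bch bhj cbj dch cfh bdh cbd bcf gfj dgj gbj fbj dfk bcfhj bcdhj hbcdf bcdfh jbdfg -dfhbj";
"ibj igj gcj icj gfj -gij -gib -gih -cij @ada -cif -bcj -bcg -fgj -fgc @aca fgic cfgij cbgij
-cigh @aia gbcfi cbfgj -hjg @aka -bfgc -hjb -hji -bfj @ala -chg gcfhi cfghi -chd -chfe -fhcg
-fhe @ana !acp -cef cbefj fcegh cefgh -ced -egfc cdefh -egh -dfc @akb @apa @asa @aaa -die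
-dih dcehi idehj icdeh !adi ecdij -beh -djei -bei -djc -djg ibcde ebcdi cbdej -bdie -bdh
jbcgi jbchi @ata bcdhj hbcdj -djhb";
"gfj gcj igj icj -gij -gib -gih @ada -bcj -bcg -fgj -fgc @aca cbgij @aia -hjg -hjb -hji @ala
-chg @aua ibghj jbchi bchij -chjb";
"icj gcj igj @ada @ava -fgj @aja -fgc @afa";
"eij igj idj dgj -djg -djei -eji jdegi -ejdg";
"gdj igj cij gcj !akg -hji -hjg jcghi -hjdc jdghi -djg jcdgi -djc";
"igj cij gcj -gij gjic !akg -gih -hji icghj -hjg jcghi -chji -chd -chg @aya -djg @akc -djc
gcdhj jcdgi @axa -djei -eji !awk jcdei -ejf icehj !awi -ceji hegij hcegi -cef -hjef -chfe
@awp jcfgh fgjc cdfhj @awd";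
"fij ihj @awm @azm";
"ifj gij @awg @azg";
"igj -gij @bae -gih @bag @bac @bai";
"gik @bca -gij";
"ifj @bca @bba";
"ghi @bda -gih";
"ihj @bea @baa";
"ehi @bfa @bam";
"@bha @bga @bao"]%string.

Definition certificate5 : seq (seq lit * seq hint) := certificate [::
"fcl fcm ckl acl -cfa -ckl -cflk cafkl -ckaf";
"ckl fcm flm acl -alc -flk @aaa -flac lacfk -alfk";
"jkl bkl fkl bfl -flk -fljb -jlk lbfjk -jlb";
"cbl bkl bgl bck -bgl -bgk -bcl bcgkl -bckg";
"adl dag gal agh -alg -aldh adghl -ahgl -ahd";
"khl gkl ckl ghk -ckl -ckg -hkl kcghl -hkcg";
"cfg ckl gcl fcl -ckl -ckg -cfg cfgkl -cflk";
"ibl ikl hbl khl bkl -ilb lbhik -ilh";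
"gdl hgl gkl dgk gcl gck !agg gcdkl";
"bjl ikl bkl bil -ilb -iljk -jlb lbijk -jlk";
"bfl jkl dbl khl hbl bkl dhl lbdhk -dlh @aca lbdfk -flk lbfhk -dlafk -fladh ladfh ladfk -aldh
-alfk";
"bdi bil hbl dbl hbi -bdi bdhil -bdh";
"hfl hjl ghj khl hgk hgl bgh hbl -ghl -ghfjb hfgjl hfgkl hbfgl -fhjb -fhkl";
"fbl jgl bhj bgl hgk hgl khl bkl hbl hjl jbl @aej jbghl bghjl @ama lbfhk lbfhj -flk -fljb";
"dbl hil bkl hbl jkl khl bfl !acg @aka";
"dhl bil hbl bdl -ilb -ilh -dlh lbdhi -dlib";
"beh ihj hci bch eil bil chj cfj cfh ecf cdf cdh hbi bdh dej -ilb -ilh -bdh -bdi @acc hbcei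
ibehl cefhj cdefh -bei bdehi -ced -bej ebcdj -cehbj";
"cbi cbm bdl bdi bil -bcl -bcid bcdil";
"bch bfl khl bkl hbl hgl bil bgl bdl hlkb -ilb @apa -ilh -dlh lbdhk lbhik iklh -dlc hlkd !ajk
@aja -iljk -ikhl -jlb -ikj -jlk lhijk khijl lbdjk -hjlk @aje -hji -ghl -ghc @aca lbfik lbdfk
-flk lbfhk -ilefk hilf fhld -dlefk -flg lfghk glhf fhlb hlkg -bgl -bgk -bch @ade -bcl -bdh
hbdjl lbcdk !aaf !abf lbcdh lbcdf -bdi -ckl -cid -cih hlkc hbcjl fhlc bdikl bdhil -ckg cdhil
kbcgh gchkl hcdfg lcgik !afj @age -cfg cdgil cdgkl cdfgl cghik gcfil cfgil -cfde -cfdij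
-ckdij -figch kcdhj -fie -djhlk -dje @aqa @aeh dbejl bdehi bdehk -behd @abr ibekl -bej -ekf
ebfik befhj -bfj @ara cbgik cbdil ibcfl cbfhi gbcfl dbcfl -bfidcg";
"fcl cdl kfl dkl adl dfl -flk -flac lacdf ladfk -alc -alfk";
"cbh bdl hbl hbk ikl bil bik cil cdk kcm -bch -bcl !aed bchil bchik ibckl -ckdib";
"bfl bkl khl hgl hbl bdl bil hlkb -ilb @apa -ilh -dlh lbdhk lbhik iklh -dlc !ajk @aja -jlb
-jlk -ghl -ghc @aca lbdfk -flk lbfhk fhld -dlafk -flg lfghk glhf hlkg @ata lcdfk lcdfh -ckl
hlkc fhlc !agf -ckg gchkl lcdgh @aia !agg dcgkl @aua -bch @ade @asa -bcl -bdh -bgl !abf -bdi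
-bgk -cid -cih bdhil @ara cdikl cdhik cdgil hcgik bchik cbgik ibcgh hcdfg bcghk gbcdh -bgidc";
"bch dkl bkl gbl hfl fbh hbl hgl bdl bil jgl gfj fgl gkl jgk fdl fbl -ilb @apa -dlh -dlc
lbdgk -bch @ade -bcl -bdh lbcdk !aaf lbcdf !abf lbcdh lbcgk -bdi -ckl @aga -cid -cih hbcfl
!agg @ara -ckg gcfjl gcdfl cdfgl cdfil cbfhi -dgc gcdkl cbdil gcdjk -dgijf fbcdl dcfgi dbcfi";
"ckl bdk dkl bkl cik cbk -ckl kbcdl -ckdib";
"ebh hbi ihj bhj fij djm faj fbj dhj bdh -dje -dji -ajf -aje @aeh !ape jbdhi jbdfi -ehi -djaf
jadef -ehd jbdef dbehj -bej -behd";
"bdi bkl bdl bil bik fbk hjk jbk hfk hdk hbk hjl hbl fdl jdl ifm hfi cbh @apa -hjlk @aje -hji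
-bfk -bfj bfhjk -bch -bcl !aed bchil -fie -fij -bdi bdikl -bdh kbdfh kbdhj hbdfk hbdjl
-dfhlk -djhlk -dji @abm !abs -ajf -aid -aje -aie @aya @acc iefhj ejia iaehj iadhj iadej
ibdeh -bei bcehi -bej -behca eabij";
"hgl khl bkl bil bdl hbl hlkb -ilb @apa -ilh lbdhk lbhik iklh hlkd !ajk @aja -iljk -ikhl -jlb
-ikj -jlk lhijk khijl lbdjk @aje @ava !apg -flk lbfhk lbfik hlkf lbdfk -flg lfghk @agt hlkg
@ana -bgl @abt -bgk -gjf -gjk !adk kbghj -bfk kbfil -bfj bfhjk @awa -bch -bcl !aed bchil
hbfik -fiklh @aza -bdi bdhil -bdh";
"fbl khl bdl hbl cbh bkl bdi bil hlkb -ilb @apa -ilh -dlh lbdhk lbhik iklh -dlc !ajk @aja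
@baa -ghl -ghc -bch -bcl !aed bchil bchik bdikl !apg -flk lbfhk lbfik lbdfk -flg lbfgh lfghi
ldfgh !adg hilg -dlag hbcgl hbcgi !agf -cih ibchk -cid @axa ibcdl lcdfk -ildag -flac lacdf
lafgi -alc -alg";
"bdi hbl khl bil cbh bdl bkl hlkb -ilb @apa -ilh -dlh lbdhk lbhik -dlc !ajk @aja -jlb -jlk
-bch -bcl !aed bchil bchik bdikl @bba @aca lbdfk -dlafk @ata lcdfk kbcil @axa";
"cbh bkl khl bil bdl hbl -bch -bcl !aed bchil @bca -bdi bdhil -bdh";
"bil bdl khl hbl bkl -hkl hlkb -ilb @apa -ilh -dlh lbhik -dlc !ajk @aja -iljk -jlb -jlk lhijk
@baa -ghl -ghc @bda -bch @ade !abd !aad -bcl -bdh -ckg !aaf !abf lbcdh -bdi -cid -cih bdhil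
@ara cdhil hcgil bchik cbdil hcdgl cbghk !aff cbdgi dbcgh ibcgh -bgidc -bgl lbghj lbghk @aat
@afk -flg -flk";
"kjl kil ibl bkl -ilb -iljk -jlk lbijk -jlb";
"khl bdl hbl bkl @bea -ilb @aha -ilh -iljk @bfa -jlk lhijk -jlih";
"hij bhk bci jik bik hbi @bfc @bgs ibhjk";
"hbi ibl bkl bch bdl hbl -ilb -ilh @bga -hkl -hkb -bch @ade -bcl -bdh bdhkl bchkl -bdi dkhb
!ack bchil @aps -cih -cid !abh !aah ibcdh -dlc -dlh dbcil dchil lbcdi lbcdk cbdkl lbcik
cbikl dbikl -ikdcl -ikb -ikj @bha -hji -hjb hbijl !ajg -jlb bchjl bdhjl -jlk -bcjed @aeh
-bdje kbijl @acc hbcei hbdei hbeil !afh dcehk cbdek dcekl lbdeh ldehk -belcd -ekdcl -bei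
-bej @abr bdeik !ads -fie -bekf @ado -fij -bfj !api -bfie";
"bch ibl bkl bdl hbl -ilb -ilh @bga -hkl -hkb -bch -bcl bchkl @aef @ace -ghl @bia hbikl hbgil
@bge !ajc -hjb -hji !acc -ehi hbegi hbeil -ehagl -ghaei haegi haegl -ahei -ahgl";
"bdl ibl bkl hbl @bga -hkl -hkb @bja -bch -bcl bchkl @ada -bckg -bgl -bghc -bgk bghkl";
"cbh bkl bhk hbl -bch -bcl bchkl @ada -bckg -bgl -bghc -bgk bghkl";
"bdi bcl ibl dbl @aed -bdi bcdil -bdlc";
"ihj hbi dbi bkl hbl gbl ibl -ilb @bka -ilh -bdi -bdh -hji -hjb hbijl @bls !ajg bdijl !bkg
!bmg -bdje !bmo bfijl -bfj bdejl befjl -bfie";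
"hdl hfl bfl hbl dbl kcl dkl kfl -dlh lbdfh -dlc -dlafk lcdfk @ata";
"bfl bkl jkl dbl dbh bch hbj ihk hci hbl ihl hkl jhl -bch -bcl -hkl -hkb !blg bchkl bdhkl
-bgk !ack ckhb @aef dlkb -bgl @ace gkhb bdghl -ghl dgkb @aca -flk -flg lbfgh @boa -dlh hbdgl
hbdkl -dlc -dghbk -ghad lcdhk !abe hadgk -ahd habdg -ahc -ahfkb habcl habjl hacik habfl
hafil hafkl hafjl -fhji -fhkb";
"beh hbj eij hej fhi eai fai fei haj hbi dbh idl dai ihl hdl daf acf afh fal !bme -bej -bei
ebhij -ehi iaefh -ehd -ahfji hbdei -ahc -ahd dahil hadil acdfh acfhl !adf";
"hbi bch hbl hkl bkl ibl -ilb @bka -ilh -bch -bcl @aed @bma -bdi -bdh -hkl -hkb !blg bchkl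
bdhkl -bgk !ack ckhb @aef -bgl bdghl -bghda @aps @bna -hji @bfc @bgs -hjb bchij hbcij bhijl
bdhij hbijl -jlb @blq !apo bdijk -jlk hjkb -dji -ikb -dje -ikj @bpa !apg !adk bfhkl -flk
-bfk kbfhl bcfkl kbcfl bdfkl -bfhda -flg -bfj bcfij -bfhde lbfgk @abt @aat !bmm !acs ibdfj
-gjf -gjk gbfjl bdgij jbfgl -fij fbijl jbfgi jbfhi ibfhj jbdfi ibdfl fbdil -dfij gfjkl fbdgj
fbghj fbgij ibdfg gbdij lbdfj -fie hcfjk -djaf -dfa @aft dbfgl -dlijfg -cfhbk @bfn -dlh -cfa
gabfi gafij fabgh fadgj fadgi !acn jadgi -ajf !aei -aifj -aje -aie jadef jadei @agl jaefh
@bqa !adi behij befhj";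
"hkl bkl ibl bch hbl -ilb -ilh -bch -bcl -hkl -hkb bchkl @aef @ace -ghl @bra hbikl hbgil @bge
-hkij !ajc -hjb -hji hbijl hbgij !acc -hjlgf -ehi hbeik hbegi hbeil -hkief -ghfei -ehfgl
hefgl hfijk -fhgl -fhei";
"khl hbl bkl ibl -ilb -ilh @aha -iljk @bfa -jlk lhijk -jlih";
"ibl hbl bkl @bta -hkl @bsa -hkb @bla";
"hfl hbl bah ghl agh hkl ahk afh hal habfl hafgl hafkl -fhkb -fhgl";
"hkl dbl bkl hbl @bua !bug -ilb -jlb -ilh !acg -dlh -dlc -hkl -hkb @bla !blg -bch -bgk -bcl
-bgl !blc lbcdh bchkl bghkl @blq @bus @ala bhikl hbikl hbckl !ack @ace gkhb bhjkl hjkb -bdi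
-ikb hgikl -ckhb -ghl -hjb -bdh -ikj -ckg -hji hbdkl bdhkl bdghl hbdgl ghkd -bghda -dghbk
-ghad -dga @abg !abe hadgk dabgh -alg @aea -ahd habdg badgk -alc labcd -ahc -ahfkb -abdh
habcl cahkl cabhl -abfk -ckaf -bckfa @bva hacfl -cfhbk -cfa -cfg acfhl !apf !bgt labfh @app
!adk bfhkl -bflca bfhil @abt @aat hbfil -bfj !acs -gjf -gjk lbghj !bmm fbhij jbfgk jbfgi
jfghk jfghl jfhil fhijl ighjl -iljfg";
"dbl bkl hbl @bua !bug -ilb -jlb -ilh -jlk @bwa !bgg @aoa";
"bkl hbl @bua !bug -ilb -jlb -ilh @bxa @bga @apa -hkl -dlh -hkb -dlc @bla !blg -bch @ade -bgk
-bcl -bdh bdhkl hbdkl -bgl !blc bchkl lbcdh !abf !aaf -bdi @blq @bus hbikl ckhb -cid -cih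
@bms bhjkl hjkb bdjkl cdhil ibcdl ibcdh -hjb -hji hdijk hcijk @acm dchij cdhjl idhjl dhijl
-jlidc";
"hbl @bya !byc @byk @bys !byo";
"kbl @bza !bya";
"hbi @bza @byc";
"bjk @caa !byk";
"bij @cba !bys";
"@cda @cca @byo"]%string.

Definition certificate6 : seq (seq lit * seq hint) := certificate [::
"eaj eij aij jco -cji -aje -ajci jacei -cjae";
"efk kfl ekl afk -akf -ake kaefl -akgl !aak -gkf -gkl kefgl kaefg";
"jak ijk fik aik afk -akf -ikj -ikdaf -akdj kadij kadfi -dkaf -dkj";
"lno ibl lin ilm lbm -lnb -lnm lbimn";
"kbn bjk jik jkn -ikj -ikb -knb kbijn -knji";
"kjl kfl fel jfl -elf -elk -jlk lefjk -jlef";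
"dfl kal fel jfl afl -alf -elf -elk -alek laefk @afa lafjk -aldjk ladfk ladef ladfj -dljk
-dlef";
"iej jek eik bek edk -bek -bej -eij ebijk -eid -beid ebdik";
"dbf fel bef bfl fdl !acd fbdel";
"bef fbo fel fdl fil -bfl @aia -bfide -filb fbeil fbdil -fied";
"flm kfl bfk kfm -bfk -bfl -fml fbklm -fmkb";
"fkm afl kal klm kfl -alf -alg -kml -kmfg klmf lafkm !aag -alhm -hlg -hlm laghm lagkm -gkl
kfglm -gkf";
"lfm bfk kfl fkm -bfk -bfl -fml fbklm -fmkb";
"eak kal kel fek egk @aak @amx -gkf";
"fjk fek jfl kfl fel -fjk fejkl -fje";
"jak jdk fdk afk fjk -akf -akdj kadfj";
"fhl flm afm fal -fml -fmah fahlm -fhlm -fha";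
"hfo lfm hfm fam fal -fha -fhlm fahlm";
"ifk faj afk fjk fcj cfk -fjk -fjaci -fikj faijk fcijk -fiac";
"ijk fik bfk bjk fjk -ikj kbfij -ikb";
"hgl lfm fhl afl !akd !ahf";
"akl kfm afk lkm akm -akf -kml -kmfg -akgl kafgm kaglm -gkf -gkl";
"kgl kal afl fkl -alf -alg @abc lafgk";
"fdk fjk jak afk -akf -akdj @apa -dkaf -dkj";
"kgl akl fkl afk -akf -akgl -gkl kafgl -gkf";
"jkl fjl afk fkl akl fdk bfk edk bjk -akf -ake -bfk -bfl -dke -dkj -jlk !afa -jlb -elf lbfjk
-elk kabfl kaefl kabel kbdef -dkib !arf -ikb -ikj kbdij";
"fck agk afk fdk cgk fjk gjk fgk @auc -dke -dkj kdfgj kacfg kcdfg kcfgj -ckaf -ckdj";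
"gfh fhl fag afl fgl -fhg faghl -fha";
"gjk afk agk fck fjk fhk fdk fgk kho -gkf @auc -dke -dkj kdfgj @baa -gkhcdj kcfgh kfghj kdfgh
-hkcdj";
"jgk fgk fjk bgk afk fkl akl bfk fdk -bfk -bfl -gkf -gkl @auc @amc kfgjl kbfgj @aza";
"gfh afg fgk hfk afk -fhg faghk -fha";
"fel kfl gfk fgl fek kjl aek eaj fjl faj efj bef abf fbl lao -gkf -gkl -alg @awf -bek -bej
ebfjk eabjk -jlk -jlb lbfjk -elf !auw fegkl -elk efgkl @amu lbejk !aqu jaefl baefl -alejb";
"cfj fjm fcm faj fam fch efj efh hfj edf aef facjm fcehj @aed";
"ijk cjk cfk fjk afk ajk fik -ikj kcfij kafij -ikcaf";
"kjl gfk fgh glm fgl fal kfl kfm fdk fbk fjk afk fek -fjk -fje -akf -ake @auc @axa -bfk -bfl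
!akc -gkf -gkl -alf fajkl fabkl -alg -fjad -ajfk bkfa -aje -abfk !afc -kml -kmb fgjkl fbgkl
gkjf -bfmg !ayb @ayd -fmg -fml fjklm @ayf @awf -bek kbdef -bej ebfjk eabjk -fhg @afb -fha
!aua fghjl !axc fghkl fbghl -hlg gbfhl -hlm lghkm -jlk kfjlm -jlb lbfjk lbgjk kbfhl gfjlm
-bhkfg -jmkfg -bhm -jmb @bfa -elf !aqb @amb -elk bejkl befgl befjl kdefl jbgkl bhjkm jbegk
-egjbl -bfjda beghj -ega -egf fegjm geflm feghj gaefl gaelm faglm -amg -amh mafhl habfm
baehj -abdj -bdkfa -bdj bdfjl lbdfk -dfjbl -dfa -dfe fabde fadeh fdekm -fhedc -fmedch @bga
fchjl fbcjl -cfhml -bfica -bfnca -cfa fabck fjkc @asa @bha @afu !auf efijk fbehi fbeim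
-fhedin -fmedin fbimn feimn fbhjn fdhjn fchjn fabhn -fnedi -fnac";
"jkl ajk kal aek fjl fjk jek bej -fjk -fje kaejl jefkl @aku";
"fgh fjk kfl afk fbk fdk gfk kfm fek kjl fgl fal -bfk -bfl -alf -alg fbgkl @ayd -fmg -fml
@afb @bia !axc lafgm";
"hfl gfh fgl fgm -fmg -fml -fhg fghlm -fhlm";
"jik fjk edk fjl bfj fhj kfl efl kfm fek fdk bfh bdf bef fmo fbm fbn efm feh hfo fln fhl -fjk
-fje -fml @awf -bek -bej ebfjk -fnlb @afu !auf !axx efijk jefik ebdfk feijl feilm fbeij
fehij fdekl fdekm fbdeh -fmedin fbimn feimn -fhedin fdhln -fnedi";
"lio kbl lbm kln kil klm -ilb lbikm @aec likmn -ilnm";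
"ilo ebl ekl kil kbl dkl -ilb lbeik -ildek ldeik lbdik -dlek -dlib";
"lgm fgl gbl kgl flm klm kil kbl lio kal fln fal kfl -alf -alg lafgm lbgkm @aib @bna lafkn";
"fal afk fjk fek fbk kfl gfk fgl -fjk -fje -gkf -gkl -bfk -bfl !akc fgjkl fbgkl gkjf @axf
fkgb -bfmg -bgkf !ayb @ayd !afc -bgm -fmg gkmf -kml -fml -kmb fjklm -akf -ake @ayf @awf -bek
-bej ebfjk kaefj -alf flka fajkl fabkl -alg @bja !aqc -ajfk -jlk kfjlm @bka @auc -aje -jlb
-fhg @bla -dke kdefj @bfa lbfjk lbgjk -fha fghkl hklf @agb fahjl fbghl -elf !aqb @amb kbfhl
!ajc kfhjl fjkln -bfnha -elk bejkl befgl befjl kdefl jbgkl jbegk -egjbl -bfjda gbjkm -egf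
-jmkfg fegjm feghl -jmb ehfb bejkm @bma -ikj @blf -ikb kbeil @boa -ilb bgikl bfikl -bfica
@bpa @aob gbfhl !aaf @abh gfhkl gfhjl -bgnh @ayh !anh -bgich -bhkfg -gnm gbhjn gbhkn @afw
-bhm -bhn mgkln kgjmn hkng behjm hbjkn -jnkfgh -jnb -jni behjn jbefn jeikn -eij @aou -eid
ebdjk @ayt !aar -bencd bcdef bdfgj bcdgi bcefn -bci -bcn";
"afl gfk kfl afk fgl fgm -fmg -fml fagkl faglm -fmah !ara -fha -fhg faghm";
"afk fgl kfl fbk fjk gfk -fjk -fje -bfk -bfl !akc fgjkl fbgkl @ayd -akf -ake @bra @bqa @abf
!akx fegjk @blu";
"glm fgm bfg gjl afg gdl fgl gbm gal dfh deh dag dgo ekm gak egk edk gfh fgj kao kdl hdk kgm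
kdm gdk dcf fdk dfg gfk klm kam kal -gkf -gkl !ayb -fmg -fml @bla -dke gfjlm @aob gbfhl !aaf
@abh gfhkl gfhjl gafhl gdfhl @ayh !anh -gnm gahln gahkn -dhefg !aeb -dgch @afw mgkln kegmn
kagmn kdegn -dhc @afv gcdhk gchjm gcfhj -akcnml -dkcnml kcdgn hcdgk kcdgm fcdgk kaclm -cknml
-ckhgf";
"fdk efj efk efl kfl kfm kfn fak feg gfk fgj gbm bfg fgm gjl gfh fal fln fgl -gkf -gkl !afc
-fmg gkmf -fml -akf -alf faklm fagkl -alg fkga @blu -elf @amb -egf -elk !axe -ega keflm !agc
kaflm @ajf -fhg @bla -fha hklf feghl hlke fakln @amf !blc kdefg kdefm kdefl edfkl kdefh -dfe
edfgk edfhl -dfa fadkl fadkm fadgk fadhk fadkn @aeh -dgef -dfchg gadel @bta lafgm @ajb fcdlm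
fcdhl fcdln fcdgl -cfhg -cfnml";
"gfh fbl kfl gfk fgl bfg gbm fak kfm fal kfn fjk efk efl -fjk -fje -gkf -gkl !akc fgjkl !ayb
@ayd !afc -fmg -fml fjklm -akf -ake fegjk fejkm @blu !abg -elf !aqb fgme -elk lbefk kefjl
keflm !ate -fhg @bla @agb feghl @bua !aox !afx edfgk edfkl edfkm -dfe efld fdehl egmd gdefm
-fhedc -dfchg fcdgh fcdeh -cfhg -cfde";
"efk fbk fjk kfl gfk fgl fal -gkf -gkl -bfk -bfl fbgkl @axf fkgb -bgkf @ayd -bgm -fmg -fml
@bsa -alf fagkl -alg @abf @amb !axe !agc !ajc @bva faghk @afb faghl";
"fgh fgl flm kfl fal gfk kfm fak !afc @afb !axc fghkl lafkm !agc";
"ghl gbl bfg afg gal efg fgl bfh hbk gfh gel kal eal hak jek aej bek eak khl hek hjk hem -bek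
-bej eabjk -egf -ega -hlg gbfhl gafhl gefhl -hlm -bhkfg @ael eaghl -bhm aehkl eahjk eabhk
hejkl hbelm -hlaejb";
"edf kfn fen efh hfk efg gfk fel kfl kfm dfk fek fem fhl fln flm fgl fcl -dfe fdekn fdehk
fdegk fdekl fdekm -dfchg fcdhl fcdln fcdlm fcdgl -cfhg -cfnml";
"cfj fhl fhj gfh fgj flm fjm fjn fjl fln fcl fchjl fcghj fcjlm fcjln -cfhg -cfnml";
"dfk kfl gfk fgl flm kfm fln fhl hfk kfn fcl fem fel efg efh fen fek dfj fjk -fjk -fje @bza
fdejk";
"dek hfk hek gfk gek fek cek cfk fdk -dke kdefh kdefg kcdef -dkchgf";
"def efh bef bfh bdf efg fgj efj dfj cef fcj -dfe fbdeh fdegj fcdej -dfchg";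
"ijk fjn kjn ifj fjk bjk fbj jdk edk bek kel kem jek jem kbn fbn fbi fbk edf fen bef -fjk
-fje -bek -bej @amu -ikj jefik jfikn jbfik @blf -ikb -eij @aou ebijk -jni eijkl eijkm bfikn
-eid edfij -jnb -eiklmn beijn ebfin";
"kal fal kfl fgl gfk fjk fbk -fjk -fje -gkf -gkl -bfk -bfl !akc fgjkl fbgkl gkjf -gjfk @axf
-bfmg !ayb @ayd !afc -fmg -fml fjklm @bsa -akf -ake -alf faklm fagkl -alg @bwa @ayf @amx
@awf -bek kabef -bej ebfjk kaefj !ayu -aje eabjk -ajd @bxa -fhg @bla -fha fghkl hklf @agb
fbghl fghjl fkha !ajc kaefh kefhj fjkln fakln fbkln fkhb !apg kaflm !alc kabfl -elk keflm
!aff @amu kafjm -jlk !ate -elf -egf feglm feghl !bbu eajkl -jlb !arb legjk fbeln -ega faejl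
fabem eafgj jbekl jbefl eabgl jbefg -egjbm -gjmb -emfg -jmkfg -jmb befjm jbekm eabkm -emah
@bya @aob lefgh lafgm -ehklm @ajb @aib -eha afkln aehjk eahjk eabhk kafjn -akcnml kabfn @caa
-fjghcd -fjghci fcejl facjl jadfh !aef fabcg fbcgk -bfichg fjkc kacef @cba fbdjk @cca kbdef
kdefj @cda -dfe -dfa adfhj adefj -dha hadej -dhc @cea @afu !auf !axx -eij jaeik eaijk ebdfj
badef bdefg bdefh -eid -aiej !aqg ecdfj -aid ecjkl jcdek ebcjl jbcef daceh bcdef -bdkfghc
-bdi -bdj dbeij dbehi dabci @aqj !afp @akk";
"jik bek edk jak eak baf bfg beg bfh beh aej edf cef kel cek jek jdk cjk bel efj fcj fbj ade
adh bef cbf bdk bdf edh -bek -bej eabjk @amu -dha -dhc @afu !auf !axx -eij jaeik eaijk ebdfj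
badef bdefg bdefh -eid -aiej !aqg ecdfj -aid ecjkl jcdek ebcjl jbcef daceh bcdef -bdkfghc
-bdi -bdj dbeij dbehi dabci @aqj !afp @akk";
"eho afh eaf bfg eak bdf bdk cbf bef ade fbj fcj bel cjk cef bfh beg baf jak bek ifj fjk jdk
kel kem jem jek edk edf hek cek -fjk -fje -bek -bej !ayu eabjk @amu -dfe -dfa -eha eahjk
eabhk adefh eadhk @cga jefik @blf -eij eijkl eijkm @aou -eid edfij edhij -eiflmhc -ehjic
echik";
"fal fgl kfl gfk fbk fjk -fjk -fje -gkf -gkl -bfk -bfl !akc fgjkl fbgkl gkjf @axf -bfmg @ayd
!afc -fmg gkmf -fml fjklm @bsa -akf -ake -alf faklm fagkl -alg @bwa @ayf @amx @awf -bek -bej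
ebfjk kaefj !ayu -aje eabjk -ajd @bxa -fhg @bla -fha fghkl @agb fbghl fghjl fkha !ajc kaefh
fjkln fbkln @cfa lafkm -alek !axe @ajb -amfl @alb laefg -egkl @caa -amg feglm feghl !bbu
-elf fbeln -ega -fjghcd -fjghci fcejl @ath @cba faejl fabem eafgj -elk eabfg facel gefjm
-emfg keflm @amu kefjl !aef kegjm -jlk fabcg fbcgk -jmkfg -jlb !arb fjkc ekfc -jmb jbekl
jbefl @cca befjm jbekm fbdjk kbdef kdefj eabkm @cda -emah -dfe -dfa adefj @cha -eha -ehfg
eaghm";
"kel bej kbl jak kjl aej jek eak bae alo -jlk -jlb @amu lbejk jaekl eajkl bela -alejb";
"efg fek gek efj gak beg gbl kbl bae jak kfl afl kgl bej aej jek eak -alf -alg -egf !bbu -ega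
eafgj aegjk -egjbl gaejl @beb @cja @ayc laegk @aku eajkl";
"edf gek aef eak edk fek hek fgj feg dfj efj fhj geh hfo feh -fha -egf ehfa -ehfg -dfe edfgk
eadfk edfhk fdegj fdehj -egdch -ehdc -dfchg -fhedc fcdeh -cehgf @adf";
"edk afj jak fjk fgj eak hfo fhj feh geh feg hek aef gek fek fjl fbk -fjk -fje @ayf @awf -bek
-bej ebfjk -ajfk -ajd !aff @aku -jlef jefkl @aqt -jlb jbefk -dke -dkj jadfk kdejl kbdej @cla
-dfe ekfd edfjk ebdfk @ayt jbdfl bdfjk dfjkl -dfjbl";
"fek hfk gfk kln kfl gfh fgl ghl bfh fjn fjk fbk fhj -fjk -fje -gkf -gkl -bfk -bfl !akc fgjkl
fbgkl @axf fkgb -bfmg -bgkf !ayb @ayd !afc -bgm -fmg gkmf -fml fjklm @bsa -akf -ake @cia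
-alf fajkl fabkl -alg @abe -fhg @atf !ajc fkhb -hlg gbfhl @abh gfhkl -fha fkga gabfl -hlm
-bgnh @ayh !anh @alv -bhkfg mghkl fkha !agh @afw -bhn -lnm @bbd -lnb lbgkm @ayf @amx kaefh
@awf -bek kabef -bej -abfk ebfjk kaefj !ayu -ajfk eabjk -ajd baefg @cka !aff faegk feghk
gefhk @aku -jlef jefkl @aqt -jlb kfjlm kfjln !ate jbfgl jbefk gfjlm gfhjl ghjln -jmkfg -jmb
bfhjm hbgjn -jnkfgh -jnb @cma -dke -dkj jadek kbdej ebdjk -bdke !ayt jabdk bdjkl bdjln bdegj
bagjn -bdnc -bgjdch -abcn bacgn bacjn -bcn -bcjd";
"efk fbk agl kgl kfl fak -akf -ake @abf -elf -elk !aai kaefl";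
"gfh fjk kfl gfk fbk fgl -gkf -gkl -bfk -bfl !akc fgjkl fbgkl @axf !ayb @ayd !afc -fmg -fml
@bsa @cia -alf -alg @abe @coa @bla fghkl @agb fbghl fghjl !akd !ajc fjkln gbfhl @cna !anh
lgkmn @afw";
"ejl fjk fbk kfl afl gbl beg kgm gjk gfk afg fak fbh fgh bfg fjm -fjk -fje -gkf -gkl -bfk
-bfl !akc @axf fkgb -bfmg -bgkf !afc -bgm -akf -ake -alf -alg @coa @ayf @amx @awf -bek -bej
ebfjk kaefj !ayu eabjk fkga -jlef jefkl @aqt -jlb kfjlm jbefk bfjkl bfgjl @cka gbjkm faegk
fbegh -jmkfg !aej -jmb eabfh befjm -bemha";
"fgl gfk fbk fjk kfl -fjk -fje -gkf -gkl -bfk -bfl !akc fgjkl fbgkl gkjf @axf !ayb @ayd -fmg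
gkmf -fml fjklm @bsa -akf -ake @cia -alf fabkl -alg @coa @ayf @awf -bek -bej ebfjk kaefj
!ayu eabjk @cpa -fhg @afb -fha fbghl fghkl faghk gabfl baefg @cqa !aut kbefl kefjl @cja";
"kel jek eak fek fbk gfk efj kfl -fje -fjk -ake -akf @amx kaefj !ayu -bfk @cra @ayf -bfl @awf
!akc -bek -bej eabjk !aff @amu kefjl lefjk -egf fegjl @blw !bbu fbegk -jlk -ega eafgj @axf
-bfmg -jlb eabfg !afc !aoc jbefl -egjbm -fml lefkm -fjgmb efglm -fmejb";
"kfm gfk ekl kfl ael gfl akl -elk -elf -alek -alf !afc !aoc lefkm lafkm @crd -elahm -alhm
@axc !aob -hlg -hlm -hlaek lahkm";
"gfh gfk fmn gmn fgn fgm fag gak gen gan feg ham eak aef ael efl men lem kfl akl gkn nlo han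
-ake -akf -gkf -gkl -alek -egf -alf -ega -gnm -gnh fgna nafgh -fhg @atf fghmn gfhmn -fha
!bbs faegh gahkn gaehn !aej haefm aefhk aefhl eafhl haegn ehlmn kafhl hafkn afhln -hlaek
kghln -hlg -lnkeah hagln";
"fbk fek jek kfl gfk eak efj -fje -fjk -ake -akf -gkf @amx -gkl kaefj !ayu -bfk @cra @ayf
-bfl @awf !akc -bek kbefg -bej eabjk @csa -elk kaefl @aku -elf -jlef eajkl @aqt !aqb @aod
fegkl -jlb -alek jbefk bfjkl lbefg begkl !axe -egf -alf -bgl -ega !arw fagkl -bgm eabfg
gabel @cta @aux @axf !blx -fml faklm lbfkm lefkm lafkm -fmg -amfl gbfkm gbflm !aie gabfm
-amh @crw -gnm !ame -gnh galmn gklmn gflmn gelmn fgna glnf !atc -lnm mfgln magln megln -angm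
-anh nafgh @cua @ald feghl !bea gfhln gafhn gefhn faghn -hlg aghlm !ael aefhk eafhj eahjl
hafkl -hlaek";
"feg eak kfl fek bfk gfk -ake -akf -gkf @amx -gkl -bfk -bfl !abd -egf !aff @afd -ega -elk
kaefl !axe ekga aegkl -elf @cta fbekl !blx !ayx -kml kbefg -kmb kbfgm -gkmb";
"jek eak efj gfk fek kfl -fje -fjk -ake -akf @amx kaefj !ayu @cva -bfk -bfl !abd @cwa fegkl
-egf !bbu -elf @aoa -ega eafgj -elk !apd fbegk efgb @and !afc !bbx kbefl -bek ebgjk -bej";
"fgh fag fak fek efg fik gfk fjl fbg bfl fgi ifo fij fgj jfo gfl fmn fem lfm fel !ayd -fhg
!bla !bea feghk fghik fghjl !agb -fighn -fhejin -fjghni fglmn felmn -fneji -fngh";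
"afl fek jfo fel fmn fgj fij ifo fgi bfl fbg fjl fik efg gfk kfm fak kfl !abd !ayd !afc !aoc
fegkm fagkl @cya @atf !afb !agc @axc lafkm";
"gfh gfl lfm fel fal efg eaf efi lem eil aei -elf !afb @ane feghl laefm @aej eafhi -elahm
eahil";
"gfk eak efj kfl fek -fje -fjk -ake -akf @amx @cxa @abx -bek -bej ebfjk !cru !axj efjb @ayf
!ayx @amg efijk flje @afg fbjkl @cwa fkie kefjl !abd fbegl !bbu fegjk fegik eijkl @and @aaj
!ayd eafik fgikm !afc !aoc !bbx fegkm fgjlm -fmejin lefkm kbfjl @ata jefik -fiej @cza @daa
!bla !bba @cya";
"eak fgk efg efl fek -egf -ega -elf -elk @akx eafgk @aqu eafkl";
"glm gal bgl gfl !abe !abb -fml -fmg";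
"ghl fal fgh gfl @akd @dce !bla";
"glm gal fgk gfl !abe @dda -fml -bgl @ayb -fmg -bgm gbflm";
"flm fhl fal dfk afk fdo fek gkl kfl -dfa fadkl -fml @aqa fadlm faklm @aka -fmkb -bfk fbdkm
fabkm -bfl -bfjda -dfjbl !dbf fbdjl !akc";
"kfl efg fek gfl fgk -gkf -gkl @deu -ake -akf fegkl -elf !dcc !dfc -elk -alg @dfa !dbg -alf
@dbe !akf !dec -hlg @akd @dea -dfe -hlm -fhg !aye !awe -fha -amg faghl fahkl -amh maghl @dga
-fml @dbd -fmg !aaj -bfk !amv fabgk fbghk fbghm -bfmha";
"gfh fhk fkl fgk gfl @abd -bfl -bfk fbgkl !ayd -fmg -fml !afb fghkl";
"efg gfl fgk fek -gkf -gkl @deu @dha -ake @abd -akf -bfl -bfk !cra fbgkl !abf -fjk @amc !ayd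
fgkb !axf -elf !blu -fje !apd -fmg gmkf @afc -elk kaefg -fml keglm kaegl @crx !aif @agc !amf
kdefl -akhml @ajc @aic @bda fkld -hkaf fbehk -bfnhg fdgkl @bca @dia -fhg !bla fdghl -fhedc
!agb fcghk fdkln fjkln -fnlb -cfhg -fnkjdc -cfnbk fbcek -cfde fcdeh -dfchg -dfe";
"fek fgk gfl fkl @abd -bfl -bfk @dja fegkl !abf";
"jek afj agj fjk efl fkl hfl fhk gjk efk feg fgk ghk gah gfm fgh fag lmn lfn mgn hgm fkn afm
fkm agk agn agl afk mfn afn hfn -gkf -gkl -fjk -fmg gmkf @afc -fml !djd -egf -ega -fhg -fha
mgkln gaklm -amg -amh -akf -ake aefgk kaefj @axa @ayg -akdj @aao jadfk jadgk !afx fdekl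
fdhkl fadek kadgj -dfjk fdegk -dfchg -dgjkf -dga gadhk @aeb !afv gcfhm @axw !ahb @aef naflm
afhmn maghn nafkm mafkn -cmh agkln -akcnml acfkn -cmn acdfk nacfm nacfh cadfn @crr";
"dfk efl fkl hfl fjk ejk fgk feg ghk gah geh feh mgn hgm gfm fhk fgh fag aef afk efk -egf
fgke -ega fhke -ehfg !ael -akf -ake !afx fdekl fdhkl fhkd fadek !aox -dfe fdegk -dfchg kdfgh
eadfk edfgk edfhk adefg -egdch gdehk -ehdc @aeb hcefg @adf !afv gcfhm fcdhk -cehgf @aef
facek";
"afk fgj hfn afn agl agn afm lmn agj gfm fag fgh hgm mgn geh gah ghk hfl feg efl efm feh efk
lfn fkl gjk agk mfn fkm fhj fhk fjn nfo gfn fkn fgk fjk fjm -fjk -fje -fmg -egf fgje fgke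
-ega -fhg -hkgf -akf -ake aefgk faegj @dla eagjk -aje -ajd @dma @auc @axa !blc fdegk fdekl
fdekm fdehk fdkln @bca -dke -dfe -fmkjdcn -fhkjdc -fnkjdc fcgkn -dkj -dfchg -cfhg @apk fcdjm
-cfdjk";
"fgh gfl feg fgk efl fkl -gkf -gkl @abd @dka -bfl -bfk !cra fbgkl -fjk @amc @ayb !ayd !axf
-fje fgjkl -bgl -fmg !aal @afc gljf -fml fjklm !djd -egf fgje fgke -ega !afa fejlm kfgjl
-fhg !bla feghl -fha fghkl !agb fghjl !aob @ajc fbkln fjkln -fnlb @dbe gfhkl gbfhl !abh
gfhjl -alf !aqa @aaf -bgnh !ayh @anh ghjln hnjg -alg -gnm gbfhn ghjkn !afw hfgjn !akb gaekl
nfglm gakln fahln gehkl gaejl gaefl gahkl @dna kafgj faekl @ang !bbc !afx";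
"fak hfj fhl hfk afh egk kjl aeg fjk gfl gfm efl efk fkl fkm -fjk -fmg -fml -elf -elk fahjk
fahkl faekl efka -fjad -alf fkla @aqu !abg kaejl @arc -alg aefgl @ang -dfa -dfe faglm fdekl
fdklm fadkm";
"afl fhl lfm kal lkm fkl @axc lafkm";
"efl feg fkl gfl fgk @abd @dka -bfl -bfk !cra fbgkl -fjk @amc !ayd !axf -fje fgjkl -fmg @afc
-fml fjklm !djd -egf fgke -ega -elf !afa fejlm @doa -fhg !afb @dia -fha feghl fghjl ghjf
@dpa -akf @agc @bea -ake kafjl gaefk aefgk fjka !aej -ajfk aefhk -aje aehjk eafhj @dqa -alf
@ane @dbe -alg -hlg -hlm !awe @aam maghl !amv hafjm hgjlm @ara hafgm haflm haejl aefhm maefl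
aeghl -elahm";
"dfk fjk ebf efn ekn efh efk ebk ebl beo eno ehn hek eah aek adj ejk fel -fjk -fje -elf -elk
-eha !afx !aox edfkl ebdfk edfkn edfhk @axx !drg -eldib -beid -endi -ehdin eahik !dbu edfil
-eiflb -eiahn";
"ejk aeg egj egk gjl kal gkl lkm fkl bgh lgm bgl hal ghl gal bfl elm hbn abh agn gfh agh fhl
egh hgn fel eah hek beo ebk afk efh efk hfk afj hfj fjk -fjk @amc -fje -fhg -fha -elf !apd
-elk -akf -ake -hlg -hlm lghkm -gnh -gnm aeghl ehla @ame !dhx eagjk @ate -aje lbghk labgk
lbhkm lbefk -ajd hbgln !bbd laghn -lnm -lnb lbfhn lbemn bahln -anglb -anh hafgn haegn fehln
gnhe ehkln -enklgh @dsa @auc @axa !blc -dke fdehk -dkj -fhkjdc jadek @apk @crt !amj jcdef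
jcdek fachj fcdhj fjkc -cfa -cfdjk";
"afk gfl fkl fhl fel efk feg fgk -gkf -gkl @abd -bfl -bfk !cra fbgkl -fjk @amc @ayb !ayd fgkb
!axf -fje fgjkl -fmg gmkf !aal !bla @afc -kmfg gljf -fml -fhg @dia fbghl fghjl -kmb !djd
-fha ghkf -hkgf !apd -egf fgje fgke -ega -akf @agc @bea -ake @dqa gaefk aefgk -alf fajkl
@ane @dbe faehk -alg -hlg gbfhl !aej gabkl -hlm aefhk eafhk !awe @aam maghl !dbw !amv hafkm
-gnh fehkm @ara !avv hafgm haflm haefm hbefm keghm -hkmb habkm hegkm kaghm -gnm aefhm maefl
-bhm mabgh abegh ehmb ebfhk @ame -bhn -bemha galmn -bej @dta kefhj kaehj kefjm kefgj @ayg
!ayu eahjk ehjkm !ddq jdegk !dbj @axa -akdj kadgj kadjm maejk mabjk -dkj jdekm -eij !afx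
fdekm fadek -dke -eid !aad fdegk ebdkm !aar @awj dbeij bdejm -dgjkf mabde deijm -dga dafgm
-dmib -dmjkfg";
"fak afh hfj hfk fjk fel efk -fjk -akf fahjk -ake -fjad !abg @arc @dbg -dfe @dec";
"fel fkl efk fhl fgk gfl @abd -bfl -bfk !cra fbgkl -fjk @amc !ayd !axf -fje fgjkl -fmg !bla
@afc -fml -fhg @dia fghjl fjklm !djd -fha -elf @dva -akf @agc @bea @dua -ake @dqa -egf !alb
fegjm faegk feghj @ane @dbe -ega geflm aefkl fhge @aej -hlg eaghl -hlm -elahm !awe @aam
efhlm maegl maegh !amv haefm";
"gfl fhl efk fgk fkl @dwa fegkl @dra";
"hfk fgk fjk fjl afj fhl efl fgl fkl fghkl fhjkl -fhg @afb -fha -fml fahjl -fmg -alf @dbc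
-alg";
"edf feh fem adj kem jem gjk efk efj ejk feg fgk egk fhk fhj fgh -fje -fjk fegjk fgje -fhg
!blc fdehk !aox edfgk !drg edfkm !dbu -eid -eij edijm eijkm edfij edgij !afu kegij efid
kefij jefik gefik fdhik -fied -fjghci -fhkjic -fighc fchjk fcghj -cfijk -cfhg";
"fgh fhl aef ekl fkl ejk efj feg efk afk gjk fhk fgk adj -gkf @dxa -gkl kefgl -fje -fjk fegjk
faejk -fhg @afb !atf -fha -fml @aoc fgka faegh faghj fhka -fmg @blx fgjkm fegkm keflm -hkaf
fmje @dza -dfe !afx @auc @axa fdegk fdehk @bca -dke -fhkjdc -dfchg -dkj fcghk @apk -cfhg
-fjghcd -cfdjk";
"def aef efl efk agk gjk gkl afk afl kjl fhj fgj efj aej -elf -elk -fje -fjk faejk !drf jlke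
-aje -ajd !afx fadek @auc @axa adefj adfjk -dke edfkl jaekl kagjl adfkl -dkj jadkl daejl
@apk @crt -fjghcd jcdef !amj";
"edf efj feg fgk efk fhk feh gfh aef -fhg -fha faegh -dfe !blc fdegk fdehk -dfchg -fhedc
fcdgh fcdeh !aef @aed";
"aek fhl fkl fgk efk efl -elf -elk -gkf @dxa -gkl lefgk kefgl !afd -egkl -ega -ake !dba eafgk
-akf -fje -fjk fejkl fegjk faejk !afa fgje kfgjl !drf eagjk -aje -ajd @dya @eaa feghl fghjl
@eca !afx @axa fdekl kafgj kagjl @eba !aga";
"gfh fhk fak fgj fjl efl fgk fjk aeg fhl fgl fkl gjl ljo kjl -elf -elk -gkf -gkl lefgk !afd
-fhg -fha fahkl -alf -alg @dbc -fmg -fml fgjlm fgklm feglm @afc kfjlm mfjkl fgme @drd gaelm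
@aob -amg @dre -amh @dbw -gnh -gnm ghlmn @afw -lnm lfgmn lfkmn lgjmn -lnkji -jlinm lijmn
-ilnm -iljk lijkn";
"agl egl gkl gjk egk eak efl fkl fjk efk -ake -akf !abg -alg !aqw -alf kaegj faekl @ang !afx
!bbc";
"fjk efk fkl efl fhl fgk -elf -elk -gkf @dxa -gkl lefgk kefgl !afd -egkl -ega @eda -ake -akf
-fjk !abg -fje efgjk egjkl fejkl fegjk @afg -jlef legjk kfgjl @efa @dbc -fmg -fml @afb fghkl
@eea";
"bej elo fej efk fbm ebm bkm -bej @aan -bek !ayf befkm";
"ebf jfl fej flm efm efl fbm @apd fbelm";
"gfh fhk fgk fkl fhl efl efk -elf -elk -gkf @dxa -gkl lefgk kefgl !afd -egkl -ega @eda -ake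
-akf @ega -fjk !aoa -fje !blb lfgjk fegjk -fhg feghl -fha fhle fhke fahkl -alf -alg @dbc
-fmg -fml fgklm feglm fgjlm @afc keflm mefkl fgme gjmf -fmejb -kml @drd -kmb gaelm @aob
mbefk -amg -hlg gfhjl gefhl @dre -amh -hlm heglm @dbw -gnh -gnm ghlmn gfhmn gehmn ghjmn @afw
ghne -gnfejb -lnm lfgmn lefmn megln ehkmn -lnb nbegl @eha -bej -bek ebkln @eia ebfjk ebfjl
@cru -eljinm !amg eijkl";
"lfm fkl feg fgk efk fgl jfl fjo gfj -fje -fml @aoc -fmg fegkm fgjlm -fmejb -fjgmb fbejm
fbgjm -bfje -bfmg";
"fgk efk fkl efl fhl -elf -elk -gkf @dxa -gkl lefgk !afd @ega -fjk !aoa -fje fegjk @eka @afb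
fghkl @eja";
"fal akl fgl kgl fkl -alf lafgk -alg";
"flm ham ghm hfl fho fkl fhk fak -fha -fml -fmg @amv fhklm -fhkbm !ama -fmkb fabhk -bfk
-bfmha";
"fak gek ekl gfk fgl fkl -gkf -gkl -akf -ake !axg @ema -alf -alg !dfa @dhb !dbe -kml -hlg
!dea !akd -hlm -fhg lfghk @aye -fha @awe fahkl -amg -amh maghl @ena !aqa mafhl afklm faklm
hfklm -kmfah";
"jek fej gek efk !dku !dxu";
"fej fag gfk fkl afk efl egl efk -elf -elk -gkf @aof -gkl @blu -egf -ega -akf @aya -ake eafgk
eagkl -fje -fjk !aoa fegjk fagjk !blb kafjl -ajfk -aje eafjl eafgj -eljb -egjbl @epa !amu
-bej eabjl -belga";
"fgl efl gfk efk fkl -elf -elk -gkf @aof -gkl @blu -egf -ega @eoa @aya !aai @dbc @amb -fmg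
gaefl -fml @eqa -fje -fjk @dbf @crf @elx -bfl !ama -bfk";
"gfk efl efk fkl -elf -elk -gkf @aof -gkl @blu @era @abc @dkb !dew lafgk @dxb !ana !aoa !abg
@dbf @elx -bfl !ala -bfk @drb !ama";
"efl fgk efk fkl -gkf -gkl -elf -elk !esf kefgl -fjk @aff -fje @dra fejkl @esd !elb lfgkm
@drd";
"fgk efk fkl -gkf -gkl @eta !erc @abd -bfl -bfk fbgkl !ayd !axf -fmg @afc -fml !djd @esb";
"gfl fkl kgl @dkb @eub";
"afk fkl efk @eua !euf -gkf -fjk !esf -gkl -fje @eva !evf !dha @eud !dhx !eug -egf -fml -dke
-ega -fmg -dkj @evd !evg @eue !dhu !euj -hlg -eij -hlm -eid @eve !evj @euh !euk -gnm -cjd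
-gnh -cji @evh !evk @eui !dhq -cmh -ced -cmn -cea @evi @dhs -cgh -cga cega -akf @aya kafjl
-ake @ayu !akx eagjk @akj edfgk ecdgj";
"efk fkl @eua !euf -gkf -fjk !esf -gkl -fje @eva !evf !dha @eud !eug -fml -dke -fmg -dkj @evd
!evg @eue !dhu !euj -hlg -dfe -eij -hlm -dfa -eid @eve !evj !dje @euh !euk -fhg -gnm -cjd
-fha -gnh -cji @evh !evk @eui !eun -cmh -dni -cmn -dnc @evi !djm -dhc -dha dfha @ewa !awc
!auc !ayc fdegk fadkl @aua fdghl";
"fkl @exa !evc !evx -elk -elf";
"@eya !eya"]%string.

Definition refuted n cert : bool :=
  all (automorphism (2 * n + 2) (gyro_edge n)) (gyro_automorphisms n) &&
  certified (2 * n + 2) (gyro_edge n) (gyro_automorphisms n) [::] cert.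

Import Order.TTheory GRing.Theory Num.Theory.
Import numFieldNormedType.Exports.
Local Open Scope classical_set_scope.
Local Open Scope ring_scope.

(** * Crossing parity *)

Section Parity.
Variable R : realFieldType.
Implicit Types (u v w z d : R * R).

Definition cross u w := u.1 * w.2 - u.2 * w.1.

(* The edge from [u] to [w] meets the positive first axis, where the points of the axis
   are counted as lying above it. *)
Definition hits u w : bool :=
  ((0 <= u.2) != (0 <= w.2)) && ((0 <= w.2) == (0 < cross u w)).

(** What is known of a quantity near [x0]: a nonzero sign persists, and at [x0 = 0] nothing is
    claimed. *)
Definition same_sign (x0 x : R) : Prop := (0 < x0 -> 0 < x) /\ (x0 < 0 -> x < 0).

(* When [u] and [w] move slightly, [hits u w] changes by the sum of their jumps, and these
   cancel along a closed walk. *)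
Definition jump v0 v : bool := ((0 <= v.2) != (0 <= v0.2)) && (0 < v0.1).

Lemma same_sign_ge0 (x0 x : R) : x0 != 0 -> same_sign x0 x -> (0 <= x) = (0 <= x0).
Proof. by case: (ltgtP x0 0) => // h _ [p n]; [rewrite leNgt n|exact/ltW/p]. Qed.

Lemma same_sign_gt0 (x0 x : R) : x0 != 0 -> same_sign x0 x -> (0 < x) = (0 < x0).
Proof. by case: (ltgtP x0 0) => // h _ [p n]; [rewrite ltNge ltW // n|exact/p]. Qed.

(** For an edge inside the axis [cross] vanishes, and its sign after a move is unknown; [hits_right]
    and [hits_left] do without it. *)
Lemma hits_right u w : 0 < u.1 -> 0 < w.1 -> hits u w = (0 <= u.2) (+) (0 <= w.2).
Proof.
rewrite /hits /cross => hu hw; case: (leP 0 u.2) => hb; case: (leP 0 w.2) => hd //=.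
  by rewrite ltNge (_ : _ <= 0) //; nra.
by rewrite (_ : 0 < _) //; nra.
Qed.

Lemma hits_left u w : u.1 < 0 -> w.1 < 0 -> hits u w = false.
Proof.
rewrite /hits /cross => hu hw; case: (leP 0 u.2) => hb; case: (leP 0 w.2) => hd //=.
  by rewrite (_ : 0 < _) //; nra.
by rewrite ltNge (_ : _ <= 0) //; nra.
Qed.

(** The first hypothesis says that the origin is off the closed segment. Then an end can change its
    side only if it starts on the axis, and this affects the hit only if it starts to the right of
    the origin. *)
Lemma hits_jump u0 w0 u w :
  (cross u0 w0 = 0 -> 0 < u0.1 * w0.1 + u0.2 * w0.2) ->
  same_sign u0.1 u.1 -> same_sign u0.2 u.2 ->
  same_sign w0.1 w.1 -> same_sign w0.2 w.2 ->
  same_sign (cross u0 w0) (cross u w) ->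
  hits u w = hits u0 w0 (+) (jump u0 u (+) jump w0 w).
Proof.
move=> off sa sb sc sd sx; rewrite /jump.
have [b0e|b0n] := eqVneq u0.2 0; have [d0e|d0n] := eqVneq w0.2 0.
(* The edge lies in the axis, entirely on one side of the origin. *)
- have ac : 0 < u0.1 * w0.1 by move: off; rewrite /cross b0e d0e !mul0r mulr0; lra.
  have [ha|ha|ha] := ltgtP u0.1 0; last by move: ac; rewrite ha mul0r ltxx.
    have hc : w0.1 < 0 by move: ac; rewrite nmulr_rgt0.
    by rewrite !hits_left ?sa.2 ?sc.2 // (le_gtF (ltW hc)) !andbF.
  have hc : 0 < w0.1 by move: ac; rewrite pmulr_rgt0.
  rewrite !hits_right ?sa.1 ?sc.1 // hc b0e d0e !lexx.
  by case: (0 <= u.2); case: (0 <= w.2).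
(* Only [u0] is on the axis and it is not the origin, so [cross] has a definite sign, which
   persists. *)
- have xE : cross u0 w0 = u0.1 * w0.2 by rewrite /cross b0e mul0r subr0.
  have an : u0.1 != 0.
    by apply/eqP => a0; have := off; rewrite xE a0 b0e !mul0r addr0 ltxx => /(_ erefl).
  rewrite /hits (same_sign_ge0 d0n sd) (same_sign_gt0 _ sx) xE ?mulf_neq0 // b0e lexx.
  have [hd|hd|hd] := ltgtP w0.2 0; last by rewrite hd eqxx in d0n.
    rewrite nmulr_lgt0 //; have [ha|ha|ha] := ltgtP u0.1 0; last by rewrite ha eqxx in an.
      by case: (0 <= u.2).
    by case: (0 <= u.2).
  rewrite pmulr_lgt0 //; have [ha|ha|ha] := ltgtP u0.1 0; last by rewrite ha eqxx in an.
    by case: (0 <= u.2).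
  by case: (0 <= u.2).
- have xE : cross u0 w0 = - (u0.2 * w0.1) by rewrite /cross d0e mulr0 sub0r.
  have cn : w0.1 != 0.
    by apply/eqP => c0; have := off; rewrite xE c0 d0e !mulr0 addr0 oppr0 ltxx => /(_ erefl).
  rewrite /hits (same_sign_ge0 b0n sb) (same_sign_gt0 _ sx) xE ?oppr_eq0 ?mulf_neq0 //.
  rewrite d0e lexx oppr_gt0.
  have [hb|hb|hb] := ltgtP u0.2 0; last by rewrite hb eqxx in b0n.
    rewrite nmulr_rlt0 //; have [hc|hc|hc] := ltgtP w0.1 0; last by rewrite hc eqxx in cn.
      by case: (0 <= w.2).
    by case: (0 <= w.2).
  rewrite pmulr_rlt0 //; have [hc|hc|hc] := ltgtP w0.1 0; last by rewrite hc eqxx in cn.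
    by case: (0 <= w.2).
  by case: (0 <= w.2).
rewrite /hits (same_sign_ge0 b0n sb) (same_sign_ge0 d0n sd) !eqxx /= addbF.
have [//|opp /=] := eqVneq (0 <= u0.2) (0 <= w0.2).
(* The sign of [cross] matters only for ends at opposite heights. If it were zero, a positive dot
   product would contradict the identity below, whose right-hand side is nonpositive. *)
rewrite (same_sign_gt0 _ sx) //; apply/eqP => x0; have dot := off x0.
have bd : u0.2 * w0.2 < 0.
  by move: opp b0n d0n; case: (ltgtP u0.2 0) => // hb; case: (ltgtP w0.2 0) => // hd _ _ _;
    [rewrite nmulr_rlt0|rewrite pmulr_rlt0].
have : 0 < (u0.1 * w0.1) * w0.2 ^+ 2 by rewrite mulr_gt0 ?exprn_even_gt0 //; lra.
have -> : u0.1 * w0.1 * w0.2 ^+ 2 = u0.2 * w0.2 * w0.1 ^+ 2.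
  by apply/eqP; rewrite -subr_eq0 -(mulr0 (w0.1 * w0.2)) -x0 /cross; apply/eqP; ring.
by rewrite ltNge mulr_le0_ge0 ?sqr_ge0 // ltW.
Qed.

(* On the half-plane [0 < <e, _>] the indicator of the upper half-plane is a primitive
   of [hits] when the ray meets that half-plane, and [hits] vanishes otherwise. *)
Lemma hits_half_plane e u w :
  0 < e.1 * u.1 + e.2 * u.2 -> 0 < e.1 * w.1 + e.2 * w.2 ->
  hits u w = ((0 < e.1) && (0 <= u.2)) (+) ((0 < e.1) && (0 <= w.2)).
Proof.
move=> hu hw.
have key : e.1 * cross u w =
  (e.1 * u.1 + e.2 * u.2) * w.2 - (e.1 * w.1 + e.2 * w.2) * u.2 by rewrite /cross; ring.
rewrite /hits.
have [hb|hb] := leP 0 u.2; have [hd|hd] := leP 0 w.2; rewrite ?andbF ?andbT ?addbF ?addbb //=.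
  have : e.1 * cross u w < 0 by rewrite key; nra.
  have [he|he] := ltP 0 e.1; first by rewrite pmulr_rlt0 // => /ltW/le_gtF ->.
  by move=> h; case: (ltP 0 (cross u w)) => // hx; nra.
have : 0 < e.1 * cross u w by rewrite key; nra.
have [he|he] := ltP 0 e.1; first by rewrite pmulr_rgt0 // => ->.
by move=> h; case: (ltP 0 (cross u w)) => // hx; nra.
Qed.

End Parity.

Fixpoint walk_parity (V : Type) (h : V -> V -> bool) (x : V) (s : seq V) : bool :=
  if s is y :: s' then h x y (+) walk_parity h y s' else false.

Lemma walk_parity_cat V (h : V -> V -> bool) x s1 s2 :
  walk_parity h x (s1 ++ s2) = walk_parity h x s1 (+) walk_parity h (last x s1) s2.
Proof. by elim: s1 x => //= y s IH x; rewrite IH addbA. Qed.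

(** The terms in [g] telescope, so [h] and [h'] have equal parity on a closed walk. *)
Lemma walk_parity_coboundary (V : Type) (e : rel V) (h h' : V -> V -> bool) (g : V -> bool) x s :
  (forall u w, e u w -> h u w = h' u w (+) (g u (+) g w)) -> path e x s ->
  walk_parity h x s = walk_parity h' x s (+) (g x (+) g (last x s)).
Proof.
move=> hg; elim: s x => [x _|y s IH x /= /andP[xy ys]]; first by rewrite /= addbb.
rewrite (IH y ys) (hg _ _ xy).
by case: (h' x y); case: (walk_parity h' y s); case: (g x); case: (g y); case: (g (last y s)).
Qed.

(** Both level sets of [g] are relatively open in [C], hence also relatively closed. *)
Lemma connected_locally_constant (T : topologicalType) (C : set T) (g : T -> bool) x y :
  connected C -> (forall z, C z -> \forall t \near z, g t = g z) -> C x -> C y -> g x = g y.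
Proof.
move=> cC lc Cx Cy.
have op (b : bool) : exists2 U, open U & C `&` [set z | g z = b] = C `&` U.
  exists [set z | g z = b]°; first exact: open_interior.
  apply/seteqP; split=> z [Cz gz]; split=> //; last exact: interior_subset gz.
  by rewrite /interior /=; apply: filterS (lc z Cz) => t /= ->; exact: gz.
suff /seteqP[_ /(_ y Cy)[_]] : C `&` [set z | g z = g x] = C by [].
apply: cC; [by exists x|exact: op|].
have [U oU UE] := op (~~ g x); exists (~` U); first exact: open_closedC.
apply/seteqP; split=> z [Cz gz]; split=> //=.
  move=> Uz; have : (C `&` U) z by [].
  by rewrite -UE => -[_ /=]; rewrite gz; case: (g x).
apply: contra_notP gz => gz; have : (C `&` [set z | g z = ~~ g x]) z.
  by split=> //=; move: gz; case: (g z); case: (g x).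
by rewrite UE => -[].
Qed.

(** * Coordinates along a ray and their continuity *)

Section Frame.
Variable R : realType.
Implicit Types (u v w z d : R * R).

(* Coordinates of [v - z] in the orthogonal frame whose first axis points along [d]. *)
Definition frame d z v : R * R :=
  ((v.1 - z.1) * d.1 + (v.2 - z.2) * d.2, (v.2 - z.2) * d.1 - (v.1 - z.1) * d.2).

Lemma sqr_norm_gt0 d : d != 0 -> 0 < d.1 ^+ 2 + d.2 ^+ 2.
Proof.
move=> dn; rewrite lt_neqAle eq_sym paddr_eq0 ?sqr_ge0 // !sqrf_eq0 addr_ge0 ?sqr_ge0 // andbT.
by apply: contra dn; case: d => a b /= /andP[/eqP -> /eqP ->].
Qed.

(** The frame multiplies the cross and dot products of [p = u - z] and [q = w - z] by [|d|^2]. If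
    the former vanishes and the latter is nonpositive, [z] lies between [u] and [w]. *)
Lemma off_segment d z u w : d != 0 -> ~ segment u w z ->
  cross (frame d z u) (frame d z w) = 0 ->
  0 < (frame d z u).1 * (frame d z w).1 + (frame d z u).2 * (frame d z w).2.
Proof.
move=> d0 off cr0; apply: contra_notP off => /negP; rewrite -leNgt; move: cr0.
have D0 := sqr_norm_gt0 d0.
set p1 := u.1 - z.1; set p2 := u.2 - z.2; set q1 := w.1 - z.1; set q2 := w.2 - z.2.
have -> : cross (frame d z u) (frame d z w) = (d.1 ^+ 2 + d.2 ^+ 2) * (p1 * q2 - p2 * q1).
  by rewrite /cross /frame /p1 /p2 /q1 /q2 /=; ring.
have -> : (frame d z u).1 * (frame d z w).1 + (frame d z u).2 * (frame d z w).2 =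
  (d.1 ^+ 2 + d.2 ^+ 2) * (p1 * q1 + p2 * q2) by rewrite /frame /p1 /p2 /q1 /q2 /=; ring.
move/eqP; rewrite mulf_eq0 (gt_eqF D0) /= subr_eq0 => /eqP pxq; rewrite pmulr_rle0 // => pq.
(* [P = <p, p - q>] and [Q = <q, q - p>]. For parallel [p] and [q] the vector [Q p + P q] vanishes,
   so [z] is the mean of [u] and [w] with weights [Q] and [P]. *)
pose P := p1 ^+ 2 + p2 ^+ 2 - (p1 * q1 + p2 * q2).
pose Q := q1 ^+ 2 + q2 ^+ 2 - (p1 * q1 + p2 * q2).
have P0 : 0 <= P by rewrite subr_ge0 (le_trans pq) // addr_ge0 ?sqr_ge0.
have Q0 : 0 <= Q by rewrite subr_ge0 (le_trans pq) // addr_ge0 ?sqr_ge0.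
have hz : u = (z.1 + p1, z.2 + p2) by rewrite /p1 /p2; case: (u) => a b /=; congr pair; ring.
have hw : w = (z.1 + q1, z.2 + q2) by rewrite /q1 /q2; case: (w) => a b /=; congr pair; ring.
have E1 : Q * p1 + P * q1 = 0.
  have -> : Q * p1 + P * q1 = (q2 - p2) * (p1 * q2 - p2 * q1) by rewrite /P /Q; ring.
  by rewrite pxq subrr mulr0.
have E2 : Q * p2 + P * q2 = 0.
  have -> : Q * p2 + P * q2 = (p1 - q1) * (p1 * q2 - p2 * q1) by rewrite /P /Q; ring.
  by rewrite pxq subrr mulr0.
(* The total weight is [|p - q|^2]. If it is zero then [p = q], and a nonpositive dot product forces
   [p = 0]. *)
have [S0|S0] := eqVneq (Q + P) 0.
  have [Pz Qz] : P = 0 /\ Q = 0 by split; lra.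
  have : (p1 - q1) ^+ 2 + (p2 - q2) ^+ 2 = 0.
    by rewrite -[RHS]S0 /P /Q; ring.
  move/eqP; rewrite paddr_eq0 ?sqr_ge0 // !sqrf_eq0 !subr_eq0 => /andP[/eqP e1 /eqP e2].
  have : p1 ^+ 2 + p2 ^+ 2 <= 0 by move: pq; rewrite -e1 -e2 -!expr2.
  rewrite le_eqVlt ltNge addr_ge0 ?sqr_ge0 // orbF paddr_eq0 ?sqr_ge0 // !sqrf_eq0.
  move=> /andP[/eqP p10 /eqP p20].
  exists 0; first by rewrite /= in_itv /= lexx ler01.
  by rewrite subr0 scale1r scale0r addr0 hz p10 p20 !addr0; case: (z).
have Sp : 0 < Q + P by rewrite lt_neqAle eq_sym S0 addr_ge0.
exists (P / (Q + P)).
  by rewrite /= in_itv /= divr_ge0 ?(ltW Sp) //= ler_pdivrMr // mul1r lerDr.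
have tE : 1 - P / (Q + P) = Q / (Q + P) by field.
rewrite tE hz hw; case: (z) => z1 z2 /=; congr pair; rewrite /= /GRing.scale /=.
  have -> : Q / (Q + P) * (z1 + p1) + P / (Q + P) * (z1 + q1) = z1 + (Q * p1 + P * q1) / (Q + P).
    by field.
  by rewrite E1 mul0r addr0.
have -> : Q / (Q + P) * (z2 + p2) + P / (Q + P) * (z2 + q2) = z2 + (Q * p2 + P * q2) / (Q + P).
  by field.
by rewrite E2 mul0r addr0.
Qed.

Lemma cvg_fst_of (T : Type) (F : set_system T) (f : T -> R * R) (l : R * R) :
  f t @[t --> F] --> l -> (f t).1 @[t --> F] --> l.1.
Proof. by move=> fl; apply: (cvg_comp _ _ fl); exact: cvg_fst. Qed.

Lemma cvg_snd_of (T : Type) (F : set_system T) (f : T -> R * R) (l : R * R) :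
  f t @[t --> F] --> l -> (f t).2 @[t --> F] --> l.2.
Proof. by move=> fl; apply: (cvg_comp _ _ fl); exact: cvg_snd. Qed.

Lemma near_same_sign (T : Type) (F : set_system T) {FF : Filter F} (q : T -> R) (q0 : R) :
  q t @[t --> F] --> q0 -> \forall t \near F, same_sign q0 (q t).
Proof.
move=> cq; rewrite /same_sign; have [h|h|h] := ltgtP q0 0.
- by apply: filterS (cvgr_lt _ cq _ h) => t.
- by apply: filterS (cvgr_gt _ cq _ h) => t.
- by apply: nearW.
Qed.

(** Everything may move, so that the lemma serves both a base point moving in a fixed drawing and a
    drawing moving together with its base point. *)
Lemma near_hits (T : Type) (F : set_system T) {FF : Filter F} (d z u w : T -> R * R)
    (d0 z0 u0 w0 : R * R) :
  d t @[t --> F] --> d0 -> z t @[t --> F] --> z0 ->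
  u t @[t --> F] --> u0 -> w t @[t --> F] --> w0 ->
  d0 != 0 -> ~ segment u0 w0 z0 ->
  \forall t \near F, hits (frame (d t) (z t) (u t)) (frame (d t) (z t) (w t)) =
    hits (frame d0 z0 u0) (frame d0 z0 w0) (+)
    (jump (frame d0 z0 u0) (frame (d t) (z t) (u t)) (+)
     jump (frame d0 z0 w0) (frame (d t) (z t) (w t))).
Proof.
move=> cd cz cu cw dn off.
have cd1 := cvg_fst_of cd; have cd2 := cvg_snd_of cd.
have cz1 := cvg_fst_of cz; have cz2 := cvg_snd_of cz.
have cf1 (v : T -> R * R) (v0 : R * R) : v t @[t --> F] --> v0 ->
    (frame (d t) (z t) (v t)).1 @[t --> F] --> (frame d0 z0 v0).1.
  move=> cv; have cv1 := cvg_fst_of cv; have cv2 := cvg_snd_of cv.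
  rewrite /frame /=; exact: cvgD (cvgM (cvgB cv1 cz1) cd1) (cvgM (cvgB cv2 cz2) cd2).
have cf2 (v : T -> R * R) (v0 : R * R) : v t @[t --> F] --> v0 ->
    (frame (d t) (z t) (v t)).2 @[t --> F] --> (frame d0 z0 v0).2.
  move=> cv; have cv1 := cvg_fst_of cv; have cv2 := cvg_snd_of cv.
  rewrite /frame /=; exact: cvgB (cvgM (cvgB cv2 cz2) cd1) (cvgM (cvgB cv1 cz1) cd2).
have cx : cross (frame (d t) (z t) (u t)) (frame (d t) (z t) (w t)) @[t --> F] -->
    cross (frame d0 z0 u0) (frame d0 z0 w0).
  exact: cvgB (cvgM (cf1 _ _ cu) (cf2 _ _ cw)) (cvgM (cf2 _ _ cu) (cf1 _ _ cw)).
near=> t; apply: hits_jump; first exact: off_segment.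
- by near: t; exact: near_same_sign (cf1 _ _ cu).
- by near: t; exact: near_same_sign (cf2 _ _ cu).
- by near: t; exact: near_same_sign (cf1 _ _ cw).
- by near: t; exact: near_same_sign (cf2 _ _ cw).
- by near: t; exact: near_same_sign cx.
Unshelve. all: by end_near. Qed.

End Frame.

(** * Parity of closed walks in a drawing *)

Section Visibility.
Variables (R : realType) (G : sgraph).
Implicit Types (f : G -> R * R) (z d : R * R).

Definition orient (u v w : R * R) : R :=
  (v.1 - u.1) * (w.2 - u.2) - (v.2 - u.2) * (w.1 - u.1).

Definition ray_parity f d z : G -> seq G -> bool :=
  walk_parity (fun a b => hits (frame d z (f a)) (frame d z (f b))).

Lemma ray_parity_half_plane f d z c x s : d != 0 ->
  (forall a, 0 < c.1 * ((f a).1 - z.1) + c.2 * ((f a).2 - z.2)) ->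
  last x s = x -> ray_parity f d z x s = false.
Proof.
move=> /sqr_norm_gt0 dp hc lst; rewrite /ray_parity.
have walk0 (h : rel G) y t : (forall a b, h a b = false) -> walk_parity h y t = false.
  by move=> h0; elim: t y => //= y' t IH y; rewrite h0 IH.
(* The vector [c] in the frame: pairing with [e] is [|d|^2] times pairing with [c]. *)
pose e : R * R := (c.1 * d.1 + c.2 * d.2, d.1 * c.2 - d.2 * c.1).
pose g a := (0 < e.1) && (0 <= (frame d z (f a)).2).
rewrite (@walk_parity_coboundary _ (fun _ _ => true) _ (fun _ _ => false) g).
- by rewrite lst addbb walk0.
- have pos a : 0 < e.1 * (frame d z (f a)).1 + e.2 * (frame d z (f a)).2.
    rewrite (_ : _ + _ = (d.1 ^+ 2 + d.2 ^+ 2) *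
      (c.1 * ((f a).1 - z.1) + c.2 * ((f a).2 - z.2))); last by rewrite /e /frame /=; ring.
    by rewrite mulr_gt0.
  by move=> a b _; apply: hits_half_plane.
- by elim: s x {lst} => //= y s IH x.
Qed.

Lemma ray_parity_unbounded f d (C : set (R * R)) x s z : d != 0 ->
  connected C -> ~ bounded_set C ->
  (forall a b : G, adj a b -> segment (f a) (f b) `&` C = set0) ->
  path (@adj G) x s -> last x s = x -> C z -> ray_parity f d z x s = false.
Proof.
move=> dn cC unb off xs lst Cz.
pose M : R := \sum_v (`|(f v).1| + `|(f v).2|).
have leM v : `|(f v).1| <= M /\ `|(f v).2| <= M.
  have : `|(f v).1| + `|(f v).2| <= M.
    by rewrite /M (bigD1 v) //= lerDl sumr_ge0 // => i _; rewrite addr_ge0.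
  by move=> h; split; apply: le_trans h; rewrite ?lerDl ?lerDr.
(* All vertices lie in the square of radius [M], and from [y] outside it they are seen within a
   half-plane. *)
have [y [Cy My]] : exists y, C y /\ (M < `|y.1| \/ M < `|y.2|).
  apply: contra_notP unb => /forallNP nC; exists M; split; first exact: num_real.
  move=> N MN y Cy; apply: le_trans (ltW MN); rewrite prod_normE ge_max.
  by apply/andP; split; rewrite leNgt; apply/negP => h; apply: (nC y); split=> //; [left|right].
rewrite -(_ : ray_parity f d y x s = ray_parity f d z x s).
  have sgnE (q : R) : M < `|q| -> exists c : R, forall v : R, `|v| <= M -> 0 < c * (v - q).
    (* With this choice the product is [q * (q - v)], positive since [|v| < |q|]. *)
    move=> Mq; exists (- q) => v vM; rewrite mulNr -mulrN opprB.
    have qp : 0 < `|q| by apply: le_lt_trans Mq; apply: le_trans vM.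
    have : `|v * q| < q ^+ 2.
      by rewrite normrM -real_normK ?num_real // expr2 ltr_pM2r // (le_lt_trans vM).
    move/(le_lt_trans (ler_norm _)); rewrite mulrBr; lra.
  case: My => /sgnE[c hc].
    apply: (@ray_parity_half_plane _ _ _ (c, 0)) => // a.
    by rewrite /= mul0r addr0; apply: hc; case: (leM a).
  apply: (@ray_parity_half_plane _ _ _ (0, c)) => // a.
  by rewrite /= mul0r add0r; apply: hc; case: (leM a).
suff lc (t : R * R) : C t -> \forall p \near t, ray_parity f d p x s = ray_parity f d t x s.
  exact: (connected_locally_constant (g := fun t => ray_parity f d t x s) cC lc).
move=> Ct.
pose stable a b p : Prop := adj a b ->
    hits (frame d p (f a)) (frame d p (f b)) =
    hits (frame d t (f a)) (frame d t (f b)) (+)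
    (jump (frame d t (f a)) (frame d p (f a)) (+) jump (frame d t (f b)) (frame d p (f b))).
have near_ab a b : \forall p \near t, stable a b p.
  rewrite /stable; have [ab|nab] := boolP (adj a b); last by near=> p.
  have offt : ~ segment (f a) (f b) t.
    by move=> abt; have : (segment (f a) (f b) `&` C) t by []; rewrite off.
  by apply: filterS (near_hits (d := fun=> d) (z := id) (u := fun=> f a) (w := fun=> f b)
    (cvg_cst _) cvg_id (cvg_cst _) (cvg_cst _) dn offt) => p ->.
have near_a a : \forall p \near t, forall b, stable a b p.
  exact: filter_forall (near_ab a).
have near_all : \forall p \near t, forall a b, stable a b p by exact: filter_forall near_a.
apply: filterS near_all => p hp.
rewrite /ray_parity (walk_parity_coboundary
  (g := fun a => jump (frame d t (f a)) (frame d p (f a))) hp xs).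
by rewrite lst addbb addbF.
Unshelve. all: by end_near.
Qed.

(** Heights in this frame are signed areas over [ab], and [a], [b] count as above the axis. The part
    through [s1] therefore stays above, the step from [b] down to [s2] meets the ray, and the final
    step up to [a] meets the line only behind the base point. *)
Lemma ray_parity_enclosed f a b (t : R) s1 s2 : 0 < t -> t < 1 -> f a != f b ->
  all (fun v => 0 < orient (f a) (f b) (f v)) s1 ->
  all (fun v => orient (f a) (f b) (f v) < 0) s2 -> s2 != [::] ->
  ray_parity f (f b - f a) ((1 - t) *: f a + t *: f b) a (rcons s1 b ++ rcons s2 a).
Proof.
move=> t0 t1 ab up dn s2n.
have dp : 0 < (f b - f a).1 ^+ 2 + (f b - f a).2 ^+ 2.
  by apply: sqr_norm_gt0; rewrite subr_eq0 eq_sym.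
set z := (1 - t) *: f a + _; set F := frame (f b - f a) z.
have F2 v : (F v).2 = orient (f a) (f b) v.
  by rewrite /F /frame /orient /z /= /GRing.scale /=; ring.
have Fa1 : (F (f a)).1 < 0.
  have -> : (F (f a)).1 = - (t * ((f b - f a).1 ^+ 2 + (f b - f a).2 ^+ 2)).
    by rewrite /F /frame /z /= /GRing.scale /=; ring.
  by rewrite oppr_lt0 mulr_gt0.
have Fb1 : 0 < (F (f b)).1.
  have -> : (F (f b)).1 = (1 - t) * ((f b - f a).1 ^+ 2 + (f b - f a).2 ^+ 2).
    by rewrite /F /frame /z /= /GRing.scale /=; ring.
  by rewrite mulr_gt0 // subr_gt0.
have Fa2 : (F (f a)).2 = 0 by rewrite F2 /orient; ring.
have Fb2 : (F (f b)).2 = 0 by rewrite F2 /orient; ring.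
rewrite /ray_parity walk_parity_cat last_rcons.
have walk_up y : 0 <= (F (f y)).2 ->
    walk_parity (fun a b => hits (F (f a)) (F (f b))) y (rcons s1 b) = false.
  elim: s1 y up => [|v s IH] y /=; first by rewrite /hits Fb2 lexx => _ ->.
  by case/andP=> v0 vs y0; rewrite IH ?F2 ?ltW // addbF /hits y0 F2 (ltW v0).
rewrite walk_up ?Fa2 //.
case: s2 dn s2n => // v s /= /andP[v0 vs] _.
have -> : hits (F (f b)) (F (f v)).
  rewrite /hits Fb2 lexx F2 leNgt v0 /= eq_sym eqbF_neg -leNgt /cross Fb2 mul0r subr0.
  by rewrite pmulr_rle0 // F2 ltW.
suff -> : walk_parity (fun a b => hits (F (f a)) (F (f b))) v (rcons s a) = false by [].
elim: s v v0 vs => [|w s IH] v v0 /=.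
  have : 0 < (F (f v)).2 * (F (f a)).1 by rewrite nmulr_lgt0 // F2.
  by rewrite addbF /hits Fa2 lexx /cross Fa2 mulr0 sub0r oppr_gt0 => /ltW/le_gtF ->; rewrite andbF.
by case/andP=> w0 ws; rewrite IH // addbF /hits !F2 !leNgt v0 w0.
Qed.

End Visibility.

(** * General position *)

Section GenericPlacement.
Variables (R : realType) (G : sgraph).
Implicit Types (f : G -> R * R).

(** The nonzero coefficient of lowest degree dominates near 0; if [c0 = 0] the point 0 itself must
    be left out. *)
Lemma near_quadratic_neq0 (c0 c1 c2 : R) : c2 != 0 ->
  \forall e \near (0 : R)^', c0 + c1 * e + c2 * e ^+ 2 != 0.
Proof.
move=> c2n.
have near_affine (p q : R) : p != 0 -> \forall e \near (0 : R)^', p + q * e != 0.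
  move=> pn; apply: nbhs_dnbhs.
  have : p + q * e @[e --> (0 : R)] --> p + q * 0.
    by apply: cvgD; [exact: cvg_cst|apply: cvgM; [exact: cvg_cst|exact: cvg_id]].
  by move=> /cvgr_neq0; apply; rewrite mulr0 addr0.
have nz : \forall e \near (0 : R)^', e != 0 by exact: nbhs_dnbhs_neq.
have [->|c0n] := eqVneq c0 0; last first.
  have : c0 + c1 * e + c2 * e ^+ 2 @[e --> (0 : R)] --> c0 + c1 * 0 + c2 * 0 ^+ 2.
    apply: cvgD.
      by apply: cvgD; [exact: cvg_cst|apply: cvgM; [exact: cvg_cst|exact: cvg_id]].
    by apply: cvgM; [exact: cvg_cst|apply: cvgM; exact: cvg_id].
  move=> /cvgr_neq0 h; apply: nbhs_dnbhs; apply: h.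
  by rewrite mulr0 expr0n /= mulr0 !addr0.
have [->|c1n] := eqVneq c1 0.
  by apply: filterS nz => e en; rewrite mul0r !add0r mulf_neq0 ?expf_neq0.
apply: filterS2 nz (near_affine _ c2 c1n) => e en h.
by rewrite add0r expr2 mulrA -mulrDl mulf_neq0.
Qed.

(* The moment curve is in general position. *)
Definition perturbed f (e : R) (a : G) : R * R :=
  let k : R := (enum_rank a)%:R in ((f a).1 + e * k, (f a).2 + e * k ^+ 2).

Lemma near_perturbed_generic f (a b c : G) : uniq [:: a; b; c] ->
  \forall e \near (0 : R)^',
    orient (perturbed f e a) (perturbed f e b) (perturbed f e c) != 0.
Proof.
move=> abc.
have kn (x y : G) : x != y -> (enum_rank x)%:R - (enum_rank y)%:R != 0 :> R.
  move=> xy; rewrite subr_eq0 eqr_nat; apply: contra xy => /eqP h.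
  by apply/eqP/enum_rank_inj/val_inj.
pose ka : R := (enum_rank a)%:R; pose kb : R := (enum_rank b)%:R.
pose kc : R := (enum_rank c)%:R.
pose dx x y := (f x).1 - (f y).1; pose dy x y := (f x).2 - (f y).2.
(* The coefficient of [e ^+ 2] is the Vandermonde determinant of the three ranks. *)
have c2n : (kb - ka) * (kc - ka) * (kc - kb) != 0.
  move: abc; rewrite /= !inE !negb_or => /andP[/andP[ab ac] /andP[bc _]].
  by rewrite !mulf_neq0 ?kn // eq_sym.
apply: filterS (near_quadratic_neq0 (dx b a * dy c a - dy b a * dx c a)
  (dx b a * (kc ^+ 2 - ka ^+ 2) + (kb - ka) * dy c a -
   (dy b a * (kc - ka) + (kb ^+ 2 - ka ^+ 2) * dx c a)) c2n) => e.
apply: contra => /eqP <-; apply/eqP.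
by rewrite /orient /perturbed /= -/ka -/kb -/kc /dx /dy; ring.
Qed.

Lemma cvg_perturbed f a : perturbed f e a @[e --> (0 : R)] --> f a.
Proof.
have h (x k : R) : x + e * k @[e --> (0 : R)] --> x.
  rewrite -[X in _ --> X]addr0 -[X in _ + X](mul0r k).
  by apply: cvgD; [exact: cvg_cst|apply: cvgM; [exact: cvg_id|exact: cvg_cst]].
rewrite [f a]surjective_pairing; exact: (cvg_pair (h _ _) (h _ _)).
Qed.

Lemma generic_placement f (C : set (R * R)) : injective f ->
  connected C -> ~ bounded_set C -> C `&` drawing f = set0 ->
  (forall a b : G, nonedge a b -> (C `&` segment (f a) (f b)) !=set0) ->
  exists g : G -> R * R,
    (forall a b c : G, uniq [:: a; b; c] -> orient (g a) (g b) (g c) != 0) /\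
    (forall (a b : G) s1 s2, nonedge a b ->
      path (@adj G) a (rcons s1 b) -> path (@adj G) b (rcons s2 a) ->
      all (fun v => 0 < orient (g a) (g b) (g v)) s1 ->
      all (fun v => orient (g a) (g b) (g v) < 0) s2 -> False).
Proof.
move=> finj cC unb off hit.
have off_edge (a b : G) : adj a b -> segment (f a) (f b) `&` C = set0.
  move=> ab; apply/seteqP; split=> // z [abz Cz].
  by rewrite -off; split=> //; right; exists a, b.
have off_vertex (a : G) : ~ C (f a).
  move=> Ca; suff : (C `&` drawing f) (f a) by rewrite off.
  by split=> //; left; exists a.
pose vis e (a b : G) := forall s1 s2, nonedge a b ->
  path (@adj G) a (rcons s1 b) -> path (@adj G) b (rcons s2 a) ->
  all (fun v => 0 < orient (perturbed f e a) (perturbed f e b) (perturbed f e v)) s1 ->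
  all (fun v => orient (perturbed f e a) (perturbed f e b) (perturbed f e v) < 0) s2 -> False.
have near_vis (a b : G) : \forall e \near (0 : R)^', vis e a b.
  rewrite /vis; have [ab|nab] := boolP (nonedge a b); last by near=> e.
  have [z [Cz [t]]] := hit _ _ ab.
  rewrite /= in_itv /= => /andP[t0 t1] zE; subst z.
  (* [C] avoids the vertices, so the point is interior to the segment. *)
  have {}t0 : 0 < t.
    rewrite lt_neqAle t0 andbT; apply/eqP => t_0; apply: (off_vertex a).
    by move: Cz; rewrite -t_0 subr0 scale1r scale0r addr0.
  have {}t1 : t < 1.
    rewrite lt_neqAle t1 andbT; apply/eqP => t_1; apply: (off_vertex b).
    by move: Cz; rewrite t_1 subrr scale1r scale0r add0r.
  have dn : f b - f a != 0.
    by rewrite subr_eq0 (inj_eq finj) eq_sym; case/andP: ab.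
  (* The base point keeps its parameter on the moving segment. It need not stay in [C]; membership
     is used only at the unperturbed point. *)
  pose z e := (1 - t) *: perturbed f e a + t *: perturbed f e b.
  have cz : z e @[e --> (0 : R)] --> (1 - t) *: f a + t *: f b.
    by apply: cvgD; apply: cvgZr; exact: cvg_perturbed.
  have cd : perturbed f e b - perturbed f e a @[e --> (0 : R)] --> f b - f a.
    by apply: cvgB; exact: cvg_perturbed.
  pose d e := perturbed f e b - perturbed f e a.
  pose d0 := f b - f a; pose z0 := (1 - t) *: f a + t *: f b.
  pose stable u w e : Prop := adj u w ->
    hits (frame (d e) (z e) (perturbed f e u)) (frame (d e) (z e) (perturbed f e w)) =
    hits (frame d0 z0 (f u)) (frame d0 z0 (f w)) (+)
    (jump (frame d0 z0 (f u)) (frame (d e) (z e) (perturbed f e u)) (+)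
     jump (frame d0 z0 (f w)) (frame (d e) (z e) (perturbed f e w))).
  have near_uw u w : \forall e \near (0 : R)^', stable u w e.
    rewrite /stable; have [uw|nuw] := boolP (adj u w); last by near=> e.
    have offz : ~ segment (f u) (f w) z0.
      by move=> uwz; have : (segment (f u) (f w) `&` C) z0 by []; rewrite off_edge.
    apply: nbhs_dnbhs.
    by apply: filterS (near_hits cd cz (@cvg_perturbed f u) (@cvg_perturbed f w) dn offz) => e ->.
  have near_u u : \forall e \near (0 : R)^', forall w, stable u w e.
    exact: filter_forall (near_uw u).
  have near_all : \forall e \near (0 : R)^', forall u w, stable u w e.
    exact: filter_forall near_u.
  apply: filterS near_all => e st s1 s2 _ p1 p2 a1 a2.
  (* With [s2] empty, [ba] would be an edge. *)
  have s2n : s2 != [::].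
    apply: contraTneq p2 => -> /=; rewrite andbT adj_sym.
    by case/andP: ab.
  have gab : perturbed f e a != perturbed f e b.
    apply: contraTneq a2 => gE; case: s2 s2n {p2} => //= v s _.
    by rewrite gE {1}/orient !subrr !mul0r subrr ltxx.
  have pw : path (@adj G) a (rcons s1 b ++ rcons s2 a) by rewrite cat_path p1 last_rcons.
  have lw : last a (rcons s1 b ++ rcons s2 a) = a by rewrite last_cat !last_rcons.
  have := ray_parity_enclosed t0 t1 gab a1 a2 s2n.
  rewrite -/(d e) -/(z e) /ray_parity (walk_parity_coboundary
    (g := fun u => jump (frame d0 z0 (f u)) (frame (d e) (z e) (perturbed f e u))) st pw).
  rewrite lw addbb addbF.
  by have := ray_parity_unbounded dn cC unb off_edge pw lw Cz; rewrite /ray_parity => ->.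
pose gen e (a b c : G) : Prop := uniq [:: a; b; c] ->
  orient (perturbed f e a) (perturbed f e b) (perturbed f e c) != 0.
have near_gen_abc (a b c : G) : \forall e \near (0 : R)^', gen e a b c.
  rewrite /gen; have [abc|nabc] := boolP (uniq [:: a; b; c]); last by near=> e.
  by apply: filterS (near_perturbed_generic f abc) => e.
have near_gen_ab (a b : G) : \forall e \near (0 : R)^', forall c, gen e a b c.
  exact: filter_forall (near_gen_abc a b).
have near_gen_a (a : G) : \forall e \near (0 : R)^', forall b c, gen e a b c.
  exact: filter_forall (near_gen_ab a).
have near_gen : \forall e \near (0 : R)^', forall a b c, gen e a b c.
  exact: filter_forall near_gen_a.
have near_vis_a (a : G) : \forall e \near (0 : R)^', forall b, vis e a b.
  exact: filter_forall (near_vis a).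
have near_vis_all : \forall e \near (0 : R)^', forall a b, vis e a b.
  exact: filter_forall near_vis_a.
have [e [eg ev]] : exists e, (forall a b c, gen e a b c) /\ (forall a b, vis e a b).
  by apply: (@filter_ex _ (0 : R)^'); exact: filterI near_gen near_vis_all.
by exists (perturbed f e).
Unshelve. all: by end_near. Qed.

End GenericPlacement.

(** * From a placement in general position to an abstract model *)

Section PlacementModel.
Variables (R : realType) (G : sgraph) (g : G -> R * R).
Variables (N : nat) (vtx : nat -> G) (e : rel nat).

Hypothesis vtx_inj : {in [pred i | (i < N)%N] &, injective vtx}.
Hypothesis vtx_adj : {in [pred i | (i < N)%N] &, forall i j, adj (vtx i) (vtx j) = e i j}.
Hypothesis g_generic : forall a b c : G, uniq [:: a; b; c] -> orient (g a) (g b) (g c) != 0.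
Hypothesis g_visible : forall (a b : G) s1 s2, nonedge a b ->
  path (@adj G) a (rcons s1 b) -> path (@adj G) b (rcons s2 a) ->
  all (fun v => 0 < orient (g a) (g b) (g v)) s1 ->
  all (fun v => orient (g a) (g b) (g v) < 0) s2 -> False.

Let area i j k : R := orient (g (vtx i)) (g (vtx j)) (g (vtx k)).

Definition closed_left (a b : nat) : Prop :=
  exists s, [/\ path e a (rcons s b), all (fun i => (i < N)%N) s & all (fun i => 0 < area a b i) s].

(* The order of the labels only serves to make [side] antisymmetric. *)
Definition side (a b : nat) : bool :=
  if (a < b)%N then ~~ `[< closed_left a b >] else `[< closed_left b a >].

(** The label [N] acts as a point on the open side of a non-edge; the first three cases are the
    rotations that bring [N] to the end. *)
Definition placement_sign (a b c : nat) : bool :=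
  if c == N then side a b else if b == N then side c a else if a == N then side b c
  else 0 < area a b c.

Lemma area_swap a b c : area b a c = - area a b c.
Proof. by rewrite /area /orient; ring. Qed.

Lemma area_rot a b c : area b c a = area a b c.
Proof. by rewrite /area /orient; ring. Qed.

Lemma area_neq0 a b c : (a < N)%N -> (b < N)%N -> (c < N)%N ->
  a != b -> a != c -> b != c -> area a b c != 0.
Proof.
move=> la lb lc ab ac bc; apply: g_generic.
have neq i j : (i < N)%N -> (j < N)%N -> i != j -> vtx i != vtx j.
  by move=> li lj; apply: contra => /eqP/vtx_inj ij; apply/eqP/ij.
by rewrite /= !inE negb_or !neq.
Qed.

Lemma side_swap a b : a != b -> side b a = ~~ side a b.
Proof. by rewrite /side; case: ltngtP => //= _ _; rewrite negbK. Qed.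

Lemma addb_gt0 (x y : R) : x != 0 -> y != 0 -> (0 < x) (+) (0 < y) = (x * y < 0).
Proof.
have [hx|hx|->] := ltgtP x 0; rewrite ?eqxx // => _.
  by rewrite nmulr_rlt0 //; case: ltgtP.
by rewrite pmulr_rlt0 //; case: ltgtP.
Qed.

Lemma sign_area a b c : (a < N)%N -> (b < N)%N -> (c < N)%N ->
  placement_sign a b c = (0 < area a b c).
Proof. by move=> la lb lc; rewrite /placement_sign !ltn_eqF. Qed.

Lemma vtx_path a s : (a < N)%N -> all (fun i => (i < N)%N) s -> path e a s ->
  path (@adj G) (vtx a) [seq vtx i | i <- s].
Proof.
elim: s a => //= b s IH a la /andP[lb ls] /andP[eab ps].
by rewrite vtx_adj // eab IH.
Qed.

Lemma e_sym a b : (a < N)%N -> (b < N)%N -> e a b = e b a.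
Proof. by move=> la lb; rewrite -!vtx_adj // adj_sym. Qed.

Lemma rev_e_path a b s : all (fun i => (i < N)%N) [:: a, b & s] -> path e a (rcons s b) ->
  path e b (rcons (rev s) a).
Proof.
move=> /and3P[la lb ls] ps; have := rev_path e a (rcons s b).
rewrite last_rcons belast_rcons rev_cons => ->.
have : all (fun i => (i < N)%N) (rcons s b) by rewrite all_rcons lb.
by elim: (rcons s b) {ls} a la ps => //= c t IH d ld /andP[dc pt] /andP[lc lt];
  rewrite e_sym // dc IH.
Qed.

Lemma not_enclosed a b s1 s2 : (a < N)%N -> (b < N)%N -> a != b -> ~~ e a b ->
  all (fun i => (i < N)%N) s1 -> all (fun i => (i < N)%N) s2 ->
  path e a (rcons s1 b) -> path e b (rcons s2 a) ->
  all (fun i => 0 < area a b i) s1 -> all (fun i => area a b i < 0) s2 -> False.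
Proof.
move=> la lb ab nab l1 l2 p1 p2 a1 a2.
apply: (@g_visible (vtx a) (vtx b) [seq vtx i | i <- s1] [seq vtx i | i <- s2]).
- rewrite /nonedge vtx_adj // nab andbT; apply: contra ab => /eqP/vtx_inj h.
  by apply/eqP/h.
- by rewrite -map_rcons vtx_path // all_rcons lb.
- by rewrite -map_rcons vtx_path // all_rcons la.
- by rewrite all_map.
- by rewrite all_map.
Qed.

Lemma placement_model : model N e placement_sign.
Proof.
have all_pos a b s : (a < N)%N -> (b < N)%N -> all (fun i => (i < N)%N) s ->
    all (placement_sign a b) s -> all (fun i => 0 < area a b i) s.
  move=> la lb ls h; apply/allP => i si.
  by rewrite -sign_area ?(allP ls i si) //; exact: (allP h).
split.
- move=> a b c /valid_litP[ab ac bc [la lb lc]]; rewrite /placement_sign.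
  have [cN|cN] := eqVneq c N; first exact: side_swap.
  have [bN|bN] := eqVneq b N; have [aN|aN] := eqVneq a N.
  + by rewrite aN bN eqxx in ab.
  + by apply: side_swap; rewrite eq_sym.
  + exact: side_swap.
  + by rewrite area_swap oppr_gt0 -leNgt le_eqVlt (negbTE (area_neq0 _ _ _ ab ac bc)) //
      ltn_neqAle ?aN ?bN ?cN.
- move=> a b c /valid_litP[ab ac bc _]; rewrite /placement_sign area_rot.
  by have [cN|cN] := eqVneq c N; have [bN|bN] := eqVneq b N; have [aN|aN] := eqVneq a N => //;
    move: ab ac bc; rewrite ?aN ?bN ?cN ?eqxx.
- move=> p q r t hlt hu; have /and5P[lp lq lr lt _] := hlt.
  (* If no area were positive, their zero sum would make all of them vanish. *)
  have tqr : area t q r != 0.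
    move: hu; rewrite /= !inE !negb_or => /and4P[/and3P[_ _ _] /andP[qr qt] rt _].
    by rewrite area_neq0 // eq_sym.
  have sum : area q p r + area t q r + area p t r + area p q t = 0.
    by rewrite /area /orient; ring.
  rewrite /holds /= !sign_area // !addbF andbT.
  have [h1|h1] := ltP 0 (area t q r); have [h2|h2] := ltP 0 (area p t r);
    have [h3|h3] := ltP 0 (area p q t); have [h4|h4] := ltP 0 (area q p r) => //=.
    lra.
  by move: tqr; rewrite neq_lt => /orP[]; lra.
- move=> t s p q r hlt hu; have /and5P[lt ls lp lq /andP[lr _]] := hlt.
  have sum : area t s p * area t q r + area t q s * area t p r + area t s r * area t p q = 0.
    by rewrite /area /orient; ring.
  move: hu; rewrite /= !inE !negb_or.
  move=> /and5P[/and4P[ts tp tq tr] /and3P[sp sq sr] /andP[pq pr] qr _].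
  have [qs rs] : q != s /\ r != s by rewrite eq_sym sq eq_sym sr.
  (* The exclusive disjunction of two signs says that the product is negative, and three nonzero
     products with sum zero cannot all have the same sign. *)
  rewrite /holds /= !sign_area // !addbF !andbT !addb_gt0 ?area_neq0 //.
  have n1 : area t s p * area t q r != 0 by rewrite mulf_neq0 ?area_neq0.
  have n2 : area t q s * area t p r != 0 by rewrite mulf_neq0 ?area_neq0.
  have n3 : area t s r * area t p q != 0 by rewrite mulf_neq0 ?area_neq0.
  move: n1 n2 n3 sum; set x := _ * _; set y := _ * _; set z := _ * _ => n1 n2 n3 sum.
  have [h1|h1|h1] := ltgtP x 0; last by rewrite h1 eqxx in n1.
    have [h2|h2|h2] := ltgtP y 0 => //=; have [h3|h3|h3] := ltgtP z 0 => //=; lra.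
  have [h2|h2|h2] := ltgtP y 0 => //=; have [h3|h3|h3] := ltgtP z 0 => //=.
  + lra.
  + by rewrite h3 eqxx in n3.
  + by rewrite h2 eqxx in n2.
  + by rewrite h2 eqxx in n2.
- move=> a b s hlt hu nab ps; have /and3P[la lb ls] := hlt.
  have ab : a != b by move: hu; rewrite /= inE negb_or => /andP[/andP[]].
  have rs : path e b (rcons (rev s) a) by exact: rev_e_path.
  rewrite /holds /blocked map_rcons -map_comp.
  rewrite (@eq_map _ _ _ (placement_sign a b)); last by move=> x /=; rewrite addbF.
  rewrite /= addbF; apply/negP.
  have : placement_sign a b N = side a b by rewrite /placement_sign eqxx.
  move: (placement_sign a b N) => v vE cst.
  (* If the constraint failed, the whole path would lie on the side declared open. *)
  have {cst} all_v : all (fun x => placement_sign a b x == v) s.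
    case: s cst {ps rs hlt hu ls} => //= x s; rewrite all_rcons all_map => /andP[/eqP -> h].
    by rewrite eqxx.
  have neg : ~~ v -> all (fun x => area a b x < 0) s.
    move=> nv; apply/allP => x xs; have lx := allP ls _ xs.
    have := allP all_v _ xs; rewrite (negbTE nv) sign_area // => /eqP/negbT.
    rewrite -leNgt le_eqVlt.
    move: hu; rewrite /= !inE !negb_or => /and3P[/andP[_ as_] bs _].
    rewrite (negbTE (area_neq0 la lb lx ab _ _)) //=.
      by apply: contraNneq as_ => ->.
    by apply: contraNneq bs => ->.
  have pos : v -> all (fun x => 0 < area a b x) s.
    move=> vt; apply/allP => x xs; have lx := allP ls _ xs.
    by have := allP all_v _ xs; rewrite vt sign_area // => /eqP.
  have area_rev x : area b a x = - area a b x by exact: area_swap.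
  have neg_rev : ~~ v -> all (fun x => 0 < area b a x) (rev s).
    move=> /neg; rewrite all_rev; apply: sub_all => x; by rewrite area_rev oppr_gt0.
  (* Either the path, reversed if necessary, contradicts the choice made by [side], or [side]
     provides a path [s'] on the other side and the two enclose [ab]. *)
  case vv: v; move: vE; rewrite vv /side; case: ltngtP ab => // lt_ab _.
  + move=> /esym/negP; apply; apply/asboolP; exists s; split=> //; exact: pos.
  + move=> /esym/asboolP[s' [p' l' a']].
    apply: (not_enclosed la lb _ nab ls l' ps p' (pos vv)); first by rewrite neq_ltn lt_ab orbT.
    by move: a'; apply: sub_all => x; rewrite area_rev oppr_gt0.
  + move=> /esym/negbFE/asboolP[s' [p' l' a']].
    apply: (not_enclosed la lb _ nab l' _ p' rs a'); rewrite ?all_rev ?neg ?vv //.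
    by rewrite neq_ltn lt_ab.
  + move=> /esym/asboolPn; apply; exists (rev s); split; rewrite ?all_rev //.
    by rewrite -all_rev neg_rev ?vv.
Qed.

End PlacementModel.

(** * The lower bound *)

Section Numbering.
Variable m : nat.
Local Notation n := m.+1.
Local Notation N := (2 * n + 2)%N.
Local Open Scope nat_scope.

Definition gyro_at (i : nat) : gyro_vertex n :=
  if i == 0 then P_ else if i == 1 then Q_ else
  if i < n + 2 then A_ (inZp (i - 2)) else B_ (inZp (i - (n + 2))).

Definition gyro_index (v : gyro_vertex n) : nat :=
  match v with P_ => 0 | Q_ => 1 | A_ i => i + 2 | B_ i => i + (n + 2) end.

Lemma gyro_indexK : cancel gyro_index gyro_at.
Proof.
case=> [||i|i] //=; rewrite /gyro_at.
  have -> : (i + 2 == 0) = false by rewrite addn2.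
  have -> : (i + 2 == 1) = false by rewrite addn2.
  by rewrite ltn_add2r ltn_ord addnK valZpK.
have -> : (i + (n + 2) == 0) = false by rewrite addnA addn2.
have -> : (i + (n + 2) == 1) = false by rewrite addnA addn2.
by rewrite ltnNge leq_addl addnK valZpK.
Qed.

Lemma gyro_index_lt v : gyro_index v < N.
Proof.
by case: v => [||i|i] /=; try have := ltn_ord i; lia.
Qed.

Lemma gyro_atK i : i < N -> gyro_index (gyro_at i) = i.
Proof.
move=> lt_iN; rewrite /gyro_at; case: eqP => [-> //|i0]; case: eqP => [-> //|i1].
case: ltnP => lt_i /=.
  have i2 : 2 <= i by case: i i0 i1 {lt_iN lt_i} => [|[|i]].
  by rewrite modn_small ?subnK // ltn_subLR // addnC.
rewrite modn_small ?subnK // ltn_subLR // addnAC.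
by move: lt_iN; rewrite mul2n -addnn.
Qed.

(** Kept as a Boolean to be evaluated at each concrete size, in place of a proof for all [m]. *)
Definition numbering_ok : bool :=
  all (fun i => all (fun j => gyro_adj (gyro_at i) (gyro_at j) == gyro_edge n i j)
    (iota 0 N)) (iota 0 N).

Lemma gyro_at_inj : {in [pred i | i < N] &, injective gyro_at}.
Proof. by move=> i j li lj /(congr1 gyro_index); rewrite !gyro_atK. Qed.

Lemma gyro_adjE : numbering_ok ->
  {in [pred i | i < N] &, forall i j, adj (s := gyro_bipyramid n) (gyro_at i) (gyro_at j) =
    gyro_edge n i j}.
Proof.
move=> /allP ok i j li lj; have /ok/allP h : i \in iota 0 N by rewrite mem_iota.
by apply/eqP/h; rewrite mem_iota.
Qed.

End Numbering.

Lemma single_outside_obstacle (R : realType) (m : nat) cert :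
  numbering_ok m -> refuted m.+1 cert ->
  forall (f : gyro_bipyramid m.+1 -> R * R) (O : 'I_1 -> set (R * R)),
  obstacle_representation f O -> ~ exists i, outside_obstacle f (O i).
Proof.
move=> num /andP[auts cert_ok] f O [finj Oc Of Ohit] [i [x [unb sub]]].
set C := connected_component _ _ in unb sub.
have [g [gen vis]] : exists g : gyro_bipyramid m.+1 -> R * R,
    (forall a b c, uniq [:: a; b; c] -> orient (g a) (g b) (g c) != 0) /\
    (forall a b s1 s2, nonedge a b ->
      path (@adj _) a (rcons s1 b) -> path (@adj _) b (rcons s2 a) ->
      all (fun v => 0 < orient (g a) (g b) (g v)) s1 ->
      all (fun v => orient (g a) (g b) (g v) < 0) s2 -> False).
  (* The component contains the obstacle, so it meets every non-edge; it also avoids the drawing and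
     is unbounded. *)
  apply: (@generic_placement _ _ f C) => //.
  - exact: component_connected.
  - by apply/disjoints_subset; exact: connected_component_sub.
  - move=> a b /Ohit[j [z [Oz abz]]]; exists z; split=> //; apply: sub.
    by rewrite (ord1 i) -(ord1 j).
have chiP := @placement_model _ (gyro_bipyramid m.+1) _ _ (@gyro_at m) _
  (@gyro_at_inj m) (gyro_adjE num) gen vis.
by have := certified_sound auts (lemmas := [::]) _ cert_ok chiP; apply.
Qed.

(** * Minimal numbers of obstacles *)

Section Least.
Local Open Scope nat_scope.

Lemma least_eq (P : nat -> Prop) k : P k -> (forall j, P j -> k <= j) -> least P = k.
Proof.
move=> Pk mink; have h : exists j, [set j | P j /\ forall i, P i -> j <= i] j by exists k.
have [Pl minl] := xgetPex 0 h; apply/eqP.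
by rewrite eqn_leq minl // mink.
Qed.

Lemma leastP (P : nat -> Prop) k : P k -> P (least P).
Proof.
move=> Pk; pose p j := `[< P j >]; have ex : exists j, p j by exists k; exact/asboolP.
have [j /asboolP Pj minj] := ex_minnP ex.
by rewrite (@least_eq P j) // => i Pi; apply: minj; exact/asboolP.
Qed.

End Least.

Lemma obs_out_eq2 (R : realType) (G : sgraph) (u v : G) : nonedge u v ->
  (forall (f : G -> R * R) (B : 'I_1 -> set (R * R)), obstacle_representation f B ->
    ~ exists i, outside_obstacle f (B i)) ->
  (exists (f : G -> R * R) (B : 'I_2 -> set (R * R)),
    obstacle_representation f B /\ exists i, outside_obstacle f (B i)) ->
  obs_out R G = 2%N.
Proof.
move=> uv no1 rep2; have no0 (f : G -> R * R) (B : 'I_0 -> set (R * R)) :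
    ~ obstacle_representation f B by case=> _ _ _ /(_ u v uv)[[]].
rewrite /obs_out ifF.
  apply: least_eq => // k [f [B [rep out]]]; case: k B rep out => [|k] B rep out.
    by case: (no0 _ _ rep).
  by case: k B rep out => // B rep out; case: (no1 _ _ rep).
(* By [rep2] the minimum [obs] is attained and not a default value; it is not 0, as some obstacle
   must meet [uv]. *)
apply/negbTE/negP => /eqP obs0; have [f [B [rep _]]] := rep2.
have : exists (f : G -> R * R) (B : 'I_(obs R G) -> set (R * R)), obstacle_representation f B.
  by apply: (@leastP (fun k => exists (f : G -> R * R) (B : 'I_k -> set (R * R)),
    obstacle_representation f B) 2%N); exists f, B.
by rewrite obs0 => -[f' [B']]; exact: no0.
Qed.

(** * Integer drawings with two obstacles *)

Section IntegerDrawing.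
Variable R : realType.
Implicit Types (a b c d z : R * R).

Fixpoint polyline (a : R * R) (s : seq (R * R)) : set (R * R) :=
  if s is b :: s' then segment a b `|` polyline b s' else [set a].

Definition rightward_ray (a : R * R) : set (R * R) := [set (a.1 + t, a.2) | t in `[0, +oo[].

Lemma affine_pair (t : R) a b :
  (1 - t) *: a + t *: b = ((1 - t) * a.1 + t * b.1, (1 - t) * a.2 + t * b.2).
Proof. by case: a b => [? ?] [? ?]. Qed.

Lemma segment_left a b : segment a b a.
Proof.
by exists 0; [rewrite /= in_itv /= lexx ler01|rewrite subr0 scale1r scale0r addr0].
Qed.

Lemma segment_right a b : segment a b b.
Proof.
by exists 1; [rewrite /= in_itv /= lexx ler01|rewrite subrr scale1r scale0r add0r].
Qed.

Lemma cvg_affine (p q t0 : R) : p + t * q @[t --> t0] --> p + t0 * q.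
Proof. by apply: cvgD; [exact: cvg_cst|apply: cvgM; [exact: cvg_id|exact: cvg_cst]]. Qed.

Lemma connected_affine (I : interval R) (p q : R * R) :
  connected [set (p.1 + t * q.1, p.2 + t * q.2) | t in [set` I]].
Proof.
apply: connected_continuous_connected; first by apply/connected_intervalP/interval_is_interval.
apply: continuous_subspaceT => t.
have h : (p.1 + u * q.1, p.2 + u * q.2) @[u --> t] --> (p.1 + t * q.1, p.2 + t * q.2).
  exact: (cvg_pair (@cvg_affine _ _ _) (@cvg_affine _ _ _)).
exact: h.
Qed.

Lemma connected_segment a b : connected (segment a b).
Proof.
rewrite (_ : segment a b = [set (a.1 + t * (b - a).1, a.2 + t * (b - a).2) | t in `[0, 1]]).
  exact: connected_affine.
have affE (x y t : R) : (1 - t) * x + t * y = x + t * (y - x) by ring.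
by apply: eq_imagel => t _; case: a b => [a1 a2] [b1 b2]; congr pair; exact: affE.
Qed.

Lemma connected_rightward_ray a : connected (rightward_ray a).
Proof.
rewrite (_ : rightward_ray a = [set (a.1 + t * 1, a.2 + t * 0) | t in `[0, +oo[]).
  exact: (@connected_affine _ a (1, 0)).
by apply: eq_imagel => t _; rewrite mulr1 mulr0 addr0.
Qed.

Lemma polyline_head a s : polyline a s a.
Proof. by case: s => [|b s] //=; left; exact: segment_left. Qed.

Lemma connected_polyline a s : connected (polyline a s).
Proof.
elim: s a => [|b s IH] a /=; first exact: connected1.
apply: connectedU => //; last exact: connected_segment.
by exists b; split; [exact: segment_right|exact: polyline_head].
Qed.

Lemma polylineP a s z : s != [::] -> polyline a s z ->
  exists2 p, p \in zip (a :: s) s & segment p.1 p.2 z.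
Proof.
elim: s a => //= b s IH a _ [abz|bsz]; first by exists (a, b); rewrite ?mem_head.
case: s IH bsz => [|c s] IH /=.
  (* The singleton that ends a polyline is the end of its last segment. *)
  by move=> ->; exists (a, b); rewrite ?mem_head //; exact: segment_right.
by move=> /IH[//|p ps pz]; exists p => //; rewrite inE ps orbT.
Qed.

Lemma segment_polyline a s p : p \in zip (a :: s) s -> segment p.1 p.2 `<=` polyline a s.
Proof.
elim: s a => //= b s IH a; rewrite inE => /predU1P[->|/IH h]; first by move=> z; left.
by move=> z /h; right.
Qed.

Lemma orient_segment a b c d (t : R) :
  orient a b ((1 - t) *: c + t *: d) = (1 - t) * orient a b c + t * orient a b d.
Proof. by rewrite /orient /= /GRing.scale /=; ring. Qed.

Lemma orient_same a b : orient a b a = 0 /\ orient a b b = 0.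
Proof. by rewrite /orient; split; ring. Qed.

(** [orient a b] vanishes on the first segment, while on the second it is affine with end values of
    one sign. *)
Lemma segments_apart a b c d : 0 < orient a b c * orient a b d ->
  segment a b `&` segment c d = set0.
Proof.
move=> pos; apply/seteqP; split=> // z [[t _ zE] [s sI]].
move: sI; rewrite /= in_itv /= => /andP[s0 s1] zE'.
have [ha hb] := orient_same a b.
have o0 : orient a b z = 0 by rewrite -zE orient_segment ha hb !mulr0 addr0.
have : (1 - s) * orient a b c + s * orient a b d = 0 by rewrite -o0 -zE' orient_segment.
move: pos; have [h|h|h] := ltgtP (orient a b c) 0; last by rewrite h mul0r ltxx.
  by rewrite nmulr_rgt0 // => hd; nra.
by rewrite pmulr_rgt0 // => hd; nra.
Qed.

(** An affine function with end values [x], [y] of opposite sign vanishes at parameter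
    [x / (x - y)]. The zeros of [orient c d] along [ab] and of [orient a b] along [cd] are the same
    point. *)
Lemma segments_cross a b c d : orient a b c * orient a b d < 0 ->
  orient c d a * orient c d b < 0 -> (segment a b `&` segment c d) !=set0.
Proof.
have ratio (x y : R) : x * y < 0 -> x - y != 0 /\ x / (x - y) \in `[0, 1].
  move=> xy; have xny : x - y != 0.
    by apply: contraTneq xy => /subr0_eq ->; rewrite -leNgt -expr2 sqr_ge0.
  split=> //; rewrite in_itv /=.
  have [h|h|h] := ltgtP x 0; last by move: xy; rewrite h mul0r ltxx.
    have hy : 0 < y by move: xy; rewrite nmulr_rlt0.
    have d0 : x - y < 0 by lra.
    by rewrite ler_ndivlMr // ler_ndivrMr // mul0r mul1r; lra.
  have hy : y < 0 by move: xy; rewrite pmulr_rlt0.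
  have d0 : 0 < x - y by lra.
  by rewrite ler_pdivlMr // ler_pdivrMr // mul0r mul1r; lra.
move=> /ratio[n1 i1] /ratio[n2 i2].
exists ((1 - orient c d a / (orient c d a - orient c d b)) *: a +
        (orient c d a / (orient c d a - orient c d b)) *: b).
split; first by exists (orient c d a / (orient c d a - orient c d b)).
exists (orient a b c / (orient a b c - orient a b d)) => //.
have dE : orient c d a - orient c d b = - (orient a b c - orient a b d).
  by rewrite /orient; ring.
rewrite dE !affine_pair; move: n1; rewrite /orient => n1.
by congr pair; field; rewrite -oppr_eq0 ?opprB in n1 *.
Qed.

End IntegerDrawing.

(** * Integer tests for drawings *)

Definition zpoint : Type := Z * Z.

(** Makes the numerals in the drawings be read in [Z]. *)
Definition zpt (x y : Z) : zpoint := (x, y).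

Definition zorient (a b c : zpoint) : Z :=
  Z.sub (Z.mul (Z.sub b.1 a.1) (Z.sub c.2 a.2)) (Z.mul (Z.sub b.2 a.2) (Z.sub c.1 a.1)).

Definition zapart (a b c d : zpoint) : bool :=
  Z.ltb 0 (Z.mul (zorient a b c) (zorient a b d)) ||
  Z.ltb 0 (Z.mul (zorient c d a) (zorient c d b)).

Definition zcross (a b c d : zpoint) : bool :=
  Z.ltb (Z.mul (zorient a b c) (zorient a b d)) 0 &&
  Z.ltb (Z.mul (zorient c d a) (zorient c d b)) 0.

(** The ray from [q1] needs no orientation test, since all vertices have smaller first coordinates.
    Every vertex is required to have a neighbour, so an obstacle that avoids the edges avoids the
    vertices. *)
Definition two_obstacles_ok (n : nat) (pts : seq zpoint)
    (q1 : zpoint) (s1 : seq zpoint) (q2 : zpoint) (s2 : seq zpoint) : bool :=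
  let N := (2 * n + 2)%N in
  let segs := zip (q1 :: s1) s1 ++ zip (q2 :: s2) s2 in
  let at_ := nth (Z0, Z0) pts in
  [&& size pts == N, uniq pts, s1 != [::], s2 != [::], all (fun p => Z.ltb p.1 q1.1) pts,
      all (fun i => has (gyro_edge n i) (iota 0 N)) (iota 0 N) &
      all (fun i => all (fun j => (i < j)%N ==>
        if gyro_edge n i j then all (fun s => zapart (at_ i) (at_ j) s.1 s.2) segs
        else has (fun s => zcross (at_ i) (at_ j) s.1 s.2) segs) (iota 0 N)) (iota 0 N)].

Lemma convex_lt (K : realFieldType) (r x y q : K) : 0 <= r -> r <= 1 -> x < q -> y < q ->
  (1 - r) * x + r * y < q.
Proof.
move=> r0 r1 xq yq.
have h1 : 0 <= (1 - r) * (q - x) by rewrite mulr_ge0 ?subr_ge0 // ltW.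
have [->|r_n] := eqVneq r 0; first by lra.
have h2 : 0 < r * (q - y) by rewrite mulr_gt0 ?subr_gt0 // lt_neqAle eq_sym r_n.
lra.
Qed.

Lemma map_zip (S T : Type) (h : S -> T) (s t : seq S) :
  zip [seq h x | x <- s] [seq h x | x <- t] = [seq (h p.1, h p.2) | p <- zip s t].
Proof. by elim: s t => [|x s IH] [|y t] //=; rewrite IH. Qed.

(** * Obstacle representations from successful integer tests *)

Section TwoObstacles.
Variables (R : realType) (m : nat) (pts : seq zpoint).
Variables (q1 : zpoint) (s1 : seq zpoint) (q2 : zpoint) (s2 : seq zpoint).
Local Notation n := m.+1.
Local Notation N := (2 * n + 2)%N.

Definition of_Z (x : Z) : R := (int_of_Z x)%:~R.
Definition of_zpoint (p : zpoint) : R * R := (of_Z p.1, of_Z p.2).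

Lemma of_ZB x y : of_Z (Z.sub x y) = of_Z x - of_Z y.
Proof. by rewrite /of_Z -Z.add_opp_r -(rmorphB (intr : int -> R)) -(rmorphB int_of_Z). Qed.

Lemma of_ZM x y : of_Z (Z.mul x y) = of_Z x * of_Z y.
Proof. by rewrite /of_Z -(rmorphM (intr : int -> R)) -(rmorphM int_of_Z). Qed.

Lemma of_Z_gt0 x : (0 < of_Z x) = Z.ltb 0 x.
Proof.
rewrite /of_Z ltr0z; case: x => // p.
by rewrite /int_of_Z /=; have := Pos2Nat.is_pos p; case: (Pos.to_nat p) => // /Nat.lt_irrefl.
Qed.

Lemma of_Z_lt0 x : (of_Z x < 0) = Z.ltb x 0.
Proof.
rewrite -oppr_gt0 -[LHS]/(0 < - of_Z x) -sub0r -[X in X - _](_ : of_Z 0 = 0) //.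
by rewrite -of_ZB of_Z_gt0; apply/idP/idP; lia.
Qed.

Lemma of_Z_inj : injective of_Z.
Proof. by move=> x y /(intr_inj (R := R)) /(can_inj int_of_ZK). Qed.

Lemma orient_of_zpoint a b c :
  orient (of_zpoint a) (of_zpoint b) (of_zpoint c) = of_Z (zorient a b c).
Proof. by rewrite /orient /zorient !(of_ZB, of_ZM). Qed.

Lemma zapart_segments a b c d : zapart a b c d ->
  segment (of_zpoint a) (of_zpoint b) `&` segment (of_zpoint c) (of_zpoint d) = set0.
Proof.
case/orP; rewrite -of_Z_gt0 of_ZM -!orient_of_zpoint; first exact: segments_apart.
by rewrite setIC; exact: segments_apart.
Qed.

Lemma zcross_segments a b c d : zcross a b c d ->
  (segment (of_zpoint a) (of_zpoint b) `&` segment (of_zpoint c) (of_zpoint d)) !=set0.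
Proof.
by case/andP; rewrite -!of_Z_lt0 !of_ZM -!orient_of_zpoint; exact: segments_cross.
Qed.

Lemma segmentC (a b : R * R) : segment a b `<=` segment b a.
Proof.
move=> z [t]; rewrite /= in_itv /= => /andP[t0 t1] <-; exists (1 - t).
  by rewrite /= in_itv /=; apply/andP; split; lra.
by rewrite addrC opprB addrCA subrr addr0.
Qed.

Hypothesis ok : two_obstacles_ok n pts q1 s1 q2 s2.

Let f (v : gyro_bipyramid n) : R * R := of_zpoint (nth (Z0, Z0) pts (gyro_index v)).

Let obstacle (i : 'I_2) : set (R * R) :=
  if i == ord0
  then rightward_ray (of_zpoint q1) `|` polyline (of_zpoint q1) [seq of_zpoint p | p <- s1]
  else polyline (of_zpoint q2) [seq of_zpoint p | p <- s2].

Hypothesis num : numbering_ok m.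

Lemma two_obstacles : exists (f : gyro_bipyramid n -> R * R) (B : 'I_2 -> set (R * R)),
  obstacle_representation f B /\ exists i, outside_obstacle f (B i).
Proof.
case/and5P: ok => /eqP sp up s1n s2n /and3P[right deg /allP edges].
have adjE (u v : gyro_bipyramid n) : adj u v = gyro_edge n (gyro_index u) (gyro_index v).
  by rewrite -(gyro_adjE num) ?gyro_indexK // inE gyro_index_lt.
have pairs (u v : gyro_bipyramid n) : (gyro_index u < gyro_index v)%N ->
    if adj u v
    then all (fun s => zapart (nth (Z0, Z0) pts (gyro_index u)) (nth (Z0, Z0) pts (gyro_index v))
      s.1 s.2) (zip (q1 :: s1) s1 ++ zip (q2 :: s2) s2)
    else has (fun s => zcross (nth (Z0, Z0) pts (gyro_index u)) (nth (Z0, Z0) pts (gyro_index v))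
      s.1 s.2) (zip (q1 :: s1) s1 ++ zip (q2 :: s2) s2).
  move=> lt_uv; have /edges h : gyro_index u \in iota 0 N by rewrite mem_iota gyro_index_lt.
  have := allP h (gyro_index v); rewrite mem_iota gyro_index_lt lt_uv adjE; exact.
have segP (q : zpoint) (s : seq zpoint) (z : R * R) : s != [::] ->
    polyline (of_zpoint q) [seq of_zpoint p | p <- s] z ->
    exists2 p, p \in zip (q :: s) s & segment (of_zpoint p.1) (of_zpoint p.2) z.
  move=> sn /polylineP[|p]; first by case: (s) sn.
  rewrite -[of_zpoint q :: _]/[seq of_zpoint p | p <- q :: s] map_zip.
  by move=> /mapP[p' ps ->] pz; exists p'.
have off_edge u v : adj u v -> forall i, obstacle i `&` segment (f u) (f v) = set0.
  move=> uv i; apply/seteqP; split=> // z [Oz uvz].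
  wlog lt_uv : u v uv uvz / (gyro_index u < gyro_index v)%N.
    move=> wl; case: (ltngtP (gyro_index u) (gyro_index v)) => [|lt_vu|eq_uv].
    - exact: wl.
    - have vu : adj v u by rewrite adj_sym.
      exact: (wl v u vu (segmentC uvz) lt_vu).
    - by move: uv; rewrite (can_inj (@gyro_indexK m) eq_uv) adj_irr.
  have := pairs u v lt_uv; rewrite uv => /allP apart.
  have no_seg p : p \in zip (q1 :: s1) s1 ++ zip (q2 :: s2) s2 ->
      ~ segment (of_zpoint p.1) (of_zpoint p.2) z.
    move=> /apart/zapart_segments dis pz.
    by rewrite -[False]/(set0 z) -dis.
  move: Oz; rewrite /obstacle; case: ifP => _; last first.
    by move=> /(segP _ _ _ s2n)[p ps pz]; apply: (no_seg p) pz; rewrite mem_cat ps orbT.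
  case; last by move=> /(segP _ _ _ s1n)[p ps pz]; apply: (no_seg p) pz; rewrite mem_cat ps.
  (* On the ray the first coordinate is at least that of [q1], on an edge it is smaller. *)
  case=> t; rewrite /= in_itv /= andbT => t0 zE.
  have le_z : (of_zpoint q1).1 <= z.1 by rewrite -zE /= lerDl.
  have lt_right w : (f w).1 < (of_zpoint q1).1.
    rewrite -subr_gt0 /f /= -of_ZB of_Z_gt0.
    have /(all_nthP (Z0, Z0))/(_ (gyro_index w)) := right.
    by rewrite sp gyro_index_lt => /(_ isT) /Z.ltb_lt h; apply/Z.ltb_lt; lia.
  case: uvz => r; rewrite /= in_itv /= => /andP[r0 r1] zE'.
  have le_x : (of_zpoint q1).1 <= (1 - r) * (f u).1 + r * (f v).1.
    by move: le_z; rewrite -zE' affine_pair.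
  by move: le_x; rewrite leNgt convex_lt.
have off i : obstacle i `&` drawing f = set0.
  apply/seteqP; split=> // z [Oz [[v zE]|[u [v [uv uvz]]]]].
    have /(allP deg)/hasP[j] : gyro_index v \in iota 0 N by rewrite mem_iota gyro_index_lt.
    rewrite mem_iota /= => lt_j; rewrite -(gyro_atK lt_j) -adjE => vj.
    suff : (obstacle i `&` segment (f v) (f (gyro_at m j))) z by rewrite off_edge.
    by split=> //; rewrite zE; exact: segment_left.
  suff : (obstacle i `&` segment (f u) (f v)) z by rewrite off_edge.
  by split.
have conn i : connected (obstacle i).
  rewrite /obstacle; case: ifP => _; last exact: connected_polyline.
  apply: connectedU; [|exact: connected_rightward_ray|exact: connected_polyline].
  exists (of_zpoint q1); split; last exact: polyline_head.
  by exists 0; [rewrite /= in_itv /= lexx|rewrite addr0].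
exists f, obstacle; split; last first.
  exists ord0, (of_zpoint q1) => C; rewrite {}/C.
  have head : obstacle ord0 (of_zpoint q1) by rewrite /obstacle eqxx; right; exact: polyline_head.
  have sub : obstacle ord0 `<=` connected_component (~` drawing f) (of_zpoint q1).
    by apply: connected_component_max => //; apply/disjoints_subset.
  split=> // -[M [_ /(_ (M + 1))]]; rewrite ltrDl ltr01 => /(_ isT) bnd.
  (* At this parameter the first coordinate of the ray is at least [|M + 1| + 1], whatever the sign
     of [x]. *)
  pose x := of_Z q1.1; have t0 : 0 <= `|x| + `|M + 1| + 1 by rewrite !addr_ge0.
  have /sub/bnd : obstacle ord0 (x + (`|x| + `|M + 1| + 1), of_Z q1.2).
    rewrite /obstacle eqxx; left; exists (`|x| + `|M + 1| + 1) => //.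
    by rewrite /= in_itv /= t0.
  rewrite /= prod_normE ge_max /= => /andP[+ _].
  have := ler_norm (x + (`|x| + `|M + 1| + 1)); have := ler_norm (M + 1).
  have := ler_norm (- x); rewrite normrN; lra.
split=> //.
- move=> u v /eqP; rewrite /f /of_zpoint => /eqP[/of_Z_inj e1 /of_Z_inj e2].
  apply: (can_inj (@gyro_indexK m)); apply/eqP.
  rewrite -(nth_uniq (Z0, Z0) _ _ up) ?sp ?gyro_index_lt //.
  by apply/eqP; move: e1 e2; case: (nth _ _ _) => [? ?]; case: (nth _ _ _) => [? ?] /= -> ->.
- move=> i; split=> //; rewrite /obstacle; case: ifP => _.
    by exists (of_zpoint q1); right; exact: polyline_head.
  by exists (of_zpoint q2); exact: polyline_head.
- move=> u v /andP[uv nuv].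
  wlog lt_uv : u v uv nuv / (gyro_index u < gyro_index v)%N.
    move=> wl; case: (ltngtP (gyro_index u) (gyro_index v)) => [|lt_vu|eq_uv].
    - exact: wl.
    - have vu : v != u by rewrite eq_sym.
      have nvu : ~~ adj v u by rewrite adj_sym.
      have [i [z [Oz vuz]]] := wl v u vu nvu lt_vu.
      by exists i, z; split=> //; exact: segmentC.
    - by move: uv; rewrite (can_inj (@gyro_indexK m) eq_uv) eqxx.
  have := pairs u v lt_uv; rewrite (negbTE nuv) => /hasP[p].
  have inP (q : zpoint) s : p \in zip (q :: s) s ->
      segment (of_zpoint p.1) (of_zpoint p.2) `<=`
        polyline (of_zpoint q) [seq of_zpoint p | p <- s].
    move=> ps; apply: (@segment_polyline _ _ _ (of_zpoint p.1, of_zpoint p.2)).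
    rewrite -[of_zpoint q :: _]/[seq of_zpoint p | p <- q :: s] map_zip.
    by apply/mapP; exists p.
  rewrite mem_cat => /orP[] /inP sub /zcross_segments[z [uvz pz]].
    by exists ord0, z; split=> //; rewrite /obstacle eqxx; right; exact: sub.
  by exists ord_max, z; split=> //; rewrite /obstacle; exact: sub.
Qed.

End TwoObstacles.

(* The drawings were found by simulated annealing. *)
Definition points4 : seq zpoint :=
  [:: zpt 23 816; zpt 661 7; zpt 58 18; zpt 952 1000; zpt 114 737; zpt 299 934; zpt 802 1000;
      zpt 0 157; zpt 0 311; zpt 183 24].

Definition outer_start4 : zpoint := zpt 953 998.
Definition outer4 : seq zpoint :=
  [:: zpt 789 818; zpt 716 (-138); zpt 187 21; zpt (-72) (-151); zpt 44 144; zpt (-59) (-43);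
      zpt 24 521; zpt (-121) 1005; zpt 394 1010; zpt 301 905; zpt 753 973].

Definition inner_start4 : zpoint := zpt 85 365.
Definition inner4 : seq zpoint :=
  [:: zpt 195 710].

Definition points5 : seq zpoint :=
  [:: zpt 116 546; zpt 899 543; zpt 332 718; zpt 46 374; zpt 336 393; zpt 708 63;
      zpt 1000 1000; zpt 625 998; zpt 1000 188; zpt 24 32; zpt 860 697; zpt 98 921].

Definition outer_start5 : zpoint := zpt 1001 67.
Definition outer5 : seq zpoint :=
  [:: zpt 738 140; zpt 675 (-108); zpt (-97) 20; zpt 233 320; zpt (-145) 364; zpt 208 704;
      zpt 278 681; zpt 36 914; zpt 750 1081; zpt 641 977; zpt 1087 1082; zpt 895 561].

Definition inner_start5 : zpoint := zpt 295 604.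
Definition inner5 : seq zpoint :=
  [:: zpt 373 386; zpt 734 613; zpt 456 716].

Definition points6 : seq zpoint :=
  [:: zpt 883 625; zpt 400 555; zpt 989 687; zpt 1000 530; zpt 782 968; zpt 940 862;
      zpt 761 310; zpt 571 42; zpt 337 104; zpt 0 0; zpt 998 997; zpt 96 645; zpt 867 6;
      zpt 284 980].

Definition outer_start6 : zpoint := zpt 1001 455.
Definition outer6 : seq zpoint :=
  [:: zpt 786 370; zpt 1054 (-164); zpt 392 (-105); zpt 517 217; zpt 221 (-6);
      zpt (-59) (-69); zpt 205 445; zpt (-72) 576; zpt 234 711; zpt 177 1132; zpt 723 899;
      zpt 765 960; zpt 1137 1163; zpt 954 874; zpt 934 740].

Definition inner_start6 : zpoint := zpt 555 547.
Definition inner6 : seq zpoint :=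
  [:: zpt 647 387; zpt 799 518; zpt 779 773].

Lemma gyro_obs_out (R : realType) (m : nat) cert pts q1 s1 q2 s2 :
  numbering_ok m -> refuted m.+1 cert -> two_obstacles_ok m.+1 pts q1 s1 q2 s2 ->
  obs_out R (gyro_bipyramid m.+1) = 2%N.
Proof.
move=> num cert_ok drawing_ok.
apply: (@obs_out_eq2 R (gyro_bipyramid m.+1) P_ Q_) => //.
  exact: (single_outside_obstacle num cert_ok).
exact: (two_obstacles R drawing_ok num).
Qed.

Theorem proposition3p5 (R : realType) :
  obs_out R (gyro_bipyramid 4) = 2%N /\
  (obs_out R icosahedron = obs_out R (gyro_bipyramid 5) /\
   obs_out R (gyro_bipyramid 5) = 2%N) /\
  obs_out R (gyro_bipyramid 6) = 2%N.
Proof.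
split; [|split; [split=> //|]].
(* The size is the successor of the argument. Evaluation settles the numbering, the certificate and
   the drawing. *)
- by apply: (@gyro_obs_out R 3 certificate4 points4 outer_start4 outer4 inner_start4 inner4);
    vm_compute.
- by apply: (@gyro_obs_out R 4 certificate5 points5 outer_start5 outer5 inner_start5 inner5);
    vm_compute.
- by apply: (@gyro_obs_out R 5 certificate6 points6 outer_start6 outer6 inner_start6 inner6);
    vm_compute.
Qed.
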